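(* Let $\mathbb{F}$ be a field, $n\ge 3$, and let $\mathcal{A}$ be the set of point-hyperplane anti-flags of $\mathrm{PG}(n-1,\mathbb{F})$, equipped with the four relations $\sim_1,\sim_2,\sim_3,\sim_4$ defined below. Then: (1) For any distinct $i,j\in\{1,2,3,4\}$, the relation $\sim_j$ can be recovered from the relation $\sim_i$ whenever $|\mathbb{F}|\ge 3$ or $i\neq 1$. (2) If $|\mathbb{F}|=2$, then for each $j\in\{2,3,4\}$ the relation $\sim_j$ cannot be recovered from $\sim_1$.
   Context: Let $V=\mathbb{F}^n$ with $n\ge 3$, and $\mathrm{PG}(n-1,\mathbb{F})$ the associated projective space (points are 1-dimensional subspaces, hyperplanes are $(n-1)$-dimensional subspaces of $V$). A point-hyperplane anti-flag is a pair $(p,H)$ of a point $p$ and a hyperplane $H$ with $p\notin H$; $\mathcal{A}$ denotes the set of all anti-flags. For distinct anti-flags $A_1=(p_1,H_1)$, $A_2=(p_2,H_2)$: $A_1\sim_1 A_2$ iff $p_j\in H_{3-j}$ and $p_{3-j}\notin H_j$ for some $j\in\{1,2\}$; $A_1\sim_2 A_2$ iff $p_j\in H_{3-j}$ for each $j\in\{1,2\}$; $A_1\sim_3 A_2$ iff $p_1=p_2$ or $H_1=H_2$; $A_1\sim_4A_2$ iff $p_1\ne p_2$, $H_1\neq H_2$ and $p_j\notin H_{3-j}$ for each $j$. Every pair of distinct anti-flags satisfies exactly one of these. ''The relation $\sim_j$ can be recovered from $\sim_i$'' means that $\sim_j$ is determined by $\sim_i$; in particular every bijection $\mathcal{A}\to\mathcal{A}$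 preserving $\sim_i$ in both directions also preserves $\sim_j$ in both directions (and ''cannot be recovered'' means this fails). *)

(* Defs.v *)
From HB Require Import structures.
From mathcomp Require Import all_boot all_order all_algebra.

Set Implicit Arguments.
Unset Strict Implicit.
Unset Printing Implicit Defensive.

Import GRing.Theory.

(* The points and hyperplanes of PG(n-1, F) are the subspaces of F^n = 'rV[F]_n
   of dimension 1 and n-1; a point lies on a hyperplane when it is contained in
   it as a subspace. *)
Definition is_point (F : fieldType) (n : nat) (p : {vspace 'rV[F]_n}) : bool :=
  \dim p == 1.

Definition is_hyperplane (F : fieldType) (n : nat) (H : {vspace 'rV[F]_n}) :
  bool := \dim H == n.-1.

Definition is_antiflag (F : fieldType) (n : nat)
    (pH : {vspace 'rV[F]_n} * {vspace 'rV[F]_n}) : bool :=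
  [&& is_point pH.1, is_hyperplane pH.2 & ~~ (pH.1 <= pH.2)%VS].

Definition antiflag (F : fieldType) (n : nat) : Type :=
  {pH : {vspace 'rV[F]_n} * {vspace 'rV[F]_n} | is_antiflag pH}.

Definition pt (F : fieldType) (n : nat) (A : antiflag F n) :
  {vspace 'rV[F]_n} := (val A).1.

Definition hyp (F : fieldType) (n : nat) (A : antiflag F n) :
  {vspace 'rV[F]_n} := (val A).2.

Definition sim1 (F : fieldType) (n : nat) (A1 A2 : antiflag F n) : bool :=
  (A1 != A2) &&
  ((pt A1 <= hyp A2)%VS && ~~ (pt A2 <= hyp A1)%VS
   || (pt A2 <= hyp A1)%VS && ~~ (pt A1 <= hyp A2)%VS).

Definition sim2 (F : fieldType) (n : nat) (A1 A2 : antiflag F n) : bool :=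
  [&& A1 != A2, (pt A1 <= hyp A2)%VS & (pt A2 <= hyp A1)%VS].

Definition sim3 (F : fieldType) (n : nat) (A1 A2 : antiflag F n) : bool :=
  (A1 != A2) && ((pt A1 == pt A2) || (hyp A1 == hyp A2)).

Definition sim4 (F : fieldType) (n : nat) (A1 A2 : antiflag F n) : bool :=
  [&& A1 != A2, pt A1 != pt A2, hyp A1 != hyp A2,
      ~~ (pt A1 <= hyp A2)%VS & ~~ (pt A2 <= hyp A1)%VS].

(* Only the indices 1, ..., 4 are meaningful; the value elsewhere is junk. *)
Definition sim (F : fieldType) (n i : nat) : rel (antiflag F n) :=
  match i with
  | 1 => @sim1 F n
  | 2 => @sim2 F n
  | 3 => @sim3 F n
  | 4 => @sim4 F n
  | _ => fun _ _ => false
  end.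

(* S is determined by R: every bijection preserving R in both directions
   preserves S in both directions.  As R and S are boolean-valued, {mono ...}
   is the two-sided preservation R (f x) (f y) = R x y. *)
Definition recoverable (T : Type) (R S : rel T) : Prop :=
  forall f : T -> T, bijective f ->
    {mono f : x y / R x y} -> {mono f : x y / S x y}.

(* Cardinality comparisons for a type that may be infinite. *)
Definition card_ge (T : Type) (k : nat) : Prop :=
  exists f : 'I_k -> T, injective f.

Definition card_eq (T : Type) (k : nat) : Prop :=
  exists f : 'I_k -> T, bijective f.

(* Main.v *)
(** Everything goes through ~3.  If A = (p1, H1) and B = (p2, H2) are distinct
    and not ~3-related, their common ~3-neighbours are those of (p1, H2) and
    (p2, H1) that are antiflags, so there are 0, 1 or 2 of them according as
    A ~2 B, A ~1 B or A ~4 B: the relation ~3 determines all the others.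
    Conversely ~3 is recovered
    - from ~2: A ~3 B iff every C <> A in the double perp of {A, B} satisfies
      that B is in the double perp of {A, C};
    - from ~4, unless |F| = 2 and n = 3: A ~3 C iff there is B, not ~4-related
      to A and different from A and C, such that every common ~4-neighbour of A
      and B is a ~4-neighbour of C; this forces C to be (p1, H2) or (p2, H1);
    - from ~4 when |F| = 2 and n = 3: here distinct A, B have a common
      ~4-neighbour iff A ~2 B;
    - from ~1 when |F| >= 3: four distinct antiflags such that every antiflag is
      ~1-related to an even number of them form a "rectangle" (p1, H1), (p1, H2),
      (p2, H1), (p2, H2); a diagonal lies in only one rectangle, a side in many.
    When |F| = 2, an antiflag is a pair (v, w) with v.w = 1, i.e. a nonsingular
    vector of a quadratic form whose polar form is nonzero exactly on ~1-pairs.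
    The reflections of this quadratic space preserve ~1 but not ~2, ~3, ~4. *)

Require Import Defs.
From mathcomp Require Import all_boot all_order all_algebra.
From mathcomp Require Import ring.

Set Implicit Arguments.
Unset Strict Implicit.
Unset Printing Implicit Defensive.
Import GRing.Theory.

(** * Dot product and avoidance of subspaces *)

Section DotProduct.
Local Open Scope ring_scope.
Variables (F : fieldType) (n : nat).
Implicit Types (u v w x y z : 'rV[F]_n) (a b c t : F).

(* A hyperplane is encoded by a normal vector for the dot product, so that
   point-hyperplane duality becomes the exchange of the two vectors. *)
Definition dot u v : F := (u *m v^T) 0 0.

Lemma mx11_eq0 (M : 'M[F]_1) : (M == 0) = (M 0 0 == 0).
Proof.
apply/eqP/eqP => [->|M0]; first by rewrite mxE.
by apply/matrixP => i j; rewrite !ord1 M0 mxE.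
Qed.

Lemma dotC u v : dot u v = dot v u.
Proof. by rewrite /dot -[in RHS](trmxK v) -trmx_mul [RHS]mxE. Qed.

Lemma dotDl u v w : dot (u + v) w = dot u w + dot v w.
Proof. by rewrite /dot mulmxDl mxE. Qed.

Lemma dotDr u v w : dot w (u + v) = dot w u + dot w v.
Proof. by rewrite dotC dotDl !(dotC w). Qed.

Lemma dotZl a u w : dot (a *: u) w = a * dot u w.
Proof. by rewrite /dot -scalemxAl mxE. Qed.

Lemma dotZr a u w : dot w (a *: u) = a * dot w u.
Proof. by rewrite dotC dotZl dotC. Qed.

Lemma dot0l w : dot 0 w = 0.
Proof. by rewrite /dot mul0mx mxE. Qed.

Lemma dot0r w : dot w 0 = 0.
Proof. by rewrite dotC dot0l. Qed.

Lemma dot_delta i j :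
  dot (delta_mx 0 i) (delta_mx 0 j) = (i == j)%:R.
Proof. by rewrite /dot trmx_delta mul_delta_mx_cond; case: eqVneq => _;
  rewrite mxE. Qed.

Lemma dot_neq0 u v : dot u v != 0 -> (u != 0) * (v != 0).
Proof.
by move=> uv; split; apply: contraNneq uv => ->; rewrite ?dot0l ?dot0r.
Qed.

Lemma sub_dot u v x : (u <= v)%MS -> dot v x = 0 -> dot u x = 0.
Proof. by move=> /sub_rVP[a ->] vx; rewrite dotZl vx mulr0. Qed.

(** Between nonzero rows, inclusion of row spaces is proportionality; equality of points and of
    hyperplanes is expressed this way throughout. *)
Lemma sub_rV_sym u v : u != 0 -> v != 0 -> (u <= v)%MS = (v <= u)%MS.
Proof.
have aux x y : x != 0 -> (x <= y)%MS -> (y <= x)%MS.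
  move=> x0 /sub_rVP[a xE]; apply/sub_rVP; exists a^-1.
  rewrite xE scalerA mulVf ?scale1r //.
  by apply: contraNneq x0 => a0; rewrite xE a0 scale0r.
by move=> u0 v0; apply/idP/idP; apply: aux.
Qed.

Lemma sub_dot_eq0 u v x : u != 0 -> v != 0 -> (u <= v)%MS ->
  (dot u x == 0) = (dot v x == 0).
Proof.
move=> u0 v0 uv; apply/eqP/eqP; apply: sub_dot => //.
by rewrite sub_rV_sym.
Qed.

(** The columns of [cokermx M] cut out the row space of [M], so one of them does not annihilate
    [v]. *)
Lemma sep_row m (M : 'M_(m, n)) v : ~~ (v <= M)%MS ->
  exists2 y, forall u, (u <= M)%MS -> dot y u = 0 & dot y v != 0.
Proof.
rewrite submxE => /matrix0Pn[i [j]]; rewrite ord1 {i} => vj.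
exists (col j (cokermx M))^T => [u|].
  rewrite submxE => /eqP u0.
  by rewrite dotC /dot trmxK colE mulmxA u0 mul0mx mxE.
by rewrite dotC /dot trmxK colE mulmxA -colE mxE.
Qed.

(** The orthogonal complement of [M] has rank at least n - m > k, too large to fit inside [N]. *)
Lemma orth_notin m k (M : 'M_(m, n)) (N : 'M_(k, n)) : (m + k < n)%N ->
  exists2 y, forall u, (u <= M)%MS -> dot y u = 0 & ~~ (y <= N)%MS.
Proof.
move=> mkn; have: ~~ (kermx M^T <= N)%MS.
  apply/negP => /mxrankS; rewrite mxrank_ker mxrank_tr => le.
  move: (rank_leq_row M) (rank_leq_row N) => Mm Nk.
  move: (leq_trans le Nk); rewrite leq_subLR leqNgt => /negP; apply.
  by apply: leq_ltn_trans mkn; rewrite leq_add2r.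
case/row_subPn => i iN; exists (row i (kermx M^T)) => // u /submxP[D ->].
have /eqP yM: row i (kermx M^T) *m M^T == 0 by rewrite -row_mul mulmx_ker row0.
by rewrite /dot trmx_mul mulmxA yM mul0mx mxE.
Qed.

Lemma orth1 w : (2 < n)%N -> forall u, exists2 y, dot y w = 0 & ~~ (y <= u)%MS.
Proof. by move=> n3 u; have [y /(_ w (submx_refl _)) yw yu] :=
  @orth_notin 1 1 w u n3; exists y. Qed.

Lemma orth2 u v : (2 < n)%N -> exists2 y, y != 0 & dot y u = 0 /\ dot y v = 0.
Proof.
move=> n3; have [y yM y0] := @orth_notin 2 0 (col_mx u v) 0 n3.
exists y; first by apply: contraNneq y0 => ->; apply: sub0mx.
have := submx_refl (col_mx u v); rewrite col_mx_sub => /andP[uM vM].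
by split; apply: yM.
Qed.

Lemma orth3 u v w : (3 < n)%N ->
  exists2 y, y != 0 & [/\ dot y u = 0, dot y v = 0 & dot y w = 0].
Proof.
move=> n4; have [y yM y0] := @orth_notin 3 0 (col_mx u (col_mx v w)) 0 n4.
exists y; first by apply: contraNneq y0 => ->; apply: sub0mx.
have := submx_refl (col_mx u (col_mx v w)).
by rewrite !col_mx_sub => /and3P[uM vM wM]; split; apply: yM.
Qed.

Lemma sep0 u : u != 0 -> exists y, dot y u != 0.
Proof. by rewrite -submx0 => /sep_row[y _]; exists y. Qed.

(** If a separator for [u] and one for [v] both fail alone, each vanishes on the other vector and
    their sum works. *)
Lemma cover2 m (M : 'M_(m, n)) u v : ~~ (u <= M)%MS -> ~~ (v <= M)%MS ->
  exists2 x, forall z, (z <= M)%MS -> dot x z = 0 &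
    (dot x u != 0) && (dot x v != 0).
Proof.
move=> /sep_row[x xM xu] /sep_row[y yM yv].
have [xv|xv] := eqVneq (dot x v) 0; last by exists x; rewrite ?xu.
have [yu|yu] := eqVneq (dot y u) 0; last by exists y; rewrite ?yu.
exists (x + y) => [z zM|]; first by rewrite dotDl xM // yM // addr0.
by rewrite !dotDl xv yu addr0 add0r xu.
Qed.

Definition has_third_scalar := exists t : F, (t != 0) && (t != 1).

(** The affine function a |-> p + a q has at most one root, so one of the two nonzero scalars 1 and
    t avoids it. *)
Lemma affine_neq0 (p q : F) : has_third_scalar -> p != 0 ->
  exists2 a, a != 0 & p + a * q != 0.
Proof.
move=> [t /andP[t0 t1]] p0; have [pq|pq] := eqVneq (p + q) 0.
  exists t => //; apply: contraNneq t1 => ptq; rewrite -subr_eq0.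
  have /eqP : (t - 1) * q = 0.
    by transitivity (p + t * q - (p + q)); [ring | rewrite ptq pq subrr].
  rewrite mulf_eq0 => /orP[//|/eqP q0].
  by move/eqP: pq; rewrite q0 addr0 (negPf p0).
by exists 1; rewrite ?oner_eq0 ?mul1r.
Qed.

(** A solution for [u] and [v] is corrected by a nonzero multiple of a separator for [w]; the third
    scalar leaves room to choose the multiple. *)
Lemma cover3 m (M : 'M_(m, n)) u v w : has_third_scalar ->
  ~~ (u <= M)%MS -> ~~ (v <= M)%MS -> ~~ (w <= M)%MS ->
  exists2 x, forall z, (z <= M)%MS -> dot x z = 0 &
    [&& dot x u != 0, dot x v != 0 & dot x w != 0].
Proof.
move=> Fb uM vM /sep_row[z zM zw]; have [x xM /andP[xu xv]] := cover2 uM vM.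
have [xw|xw] := eqVneq (dot x w) 0; last by exists x; rewrite ?xu ?xv.
have mk a : a != 0 -> dot x u + a * dot z u != 0 ->
  dot x v + a * dot z v != 0 ->
    exists2 x, forall z, (z <= M)%MS -> dot x z = 0 &
    [&& dot x u != 0, dot x v != 0 & dot x w != 0].
  move=> a0 au av; exists (x + a *: z) => [y yM|].
    by rewrite dotDl dotZl xM ?zM // mulr0 addr0.
  by rewrite !dotDl !dotZl au av xw add0r mulf_neq0.
have [zu|zu] := eqVneq (dot z u) 0.
  have [a a0 av] := affine_neq0 (dot z v) Fb xv.
  by apply: (mk a); rewrite ?zu ?mulr0 ?addr0.
have [zv|zv] := eqVneq (dot z v) 0.
  have [a a0 au] := affine_neq0 (dot z u) Fb xu.
  by apply: (mk a); rewrite ?zv ?mulr0 ?addr0.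
by exists z; rewrite ?zu ?zv.
Qed.
End DotProduct.

(** * Choosing points and hyperplanes in general position *)

Section Selection.
Local Open Scope ring_scope.
Variables (F : fieldType) (n : nat).
Hypothesis n_gt2 : (2 < n)%N.
Implicit Types (u v w x y z : 'rV[F]_n) (a b c t : F).

(** If x and x + s were both multiples of w, so would be s; then x would be a multiple of s, which
    is orthogonal to u. *)
Lemma sub_perturb x s w u : dot x u != 0 -> dot s u = 0 -> s != 0 ->
  ~~ (x <= w)%MS || ~~ ((x + s)%R <= w)%MS.
Proof.
move=> xu su s0; rewrite -negb_and; apply: contraNN xu => /andP[xw xsw].
have sw : (s <= w)%MS.
  by rewrite -(addKr x s) addmx_sub // eqmx_opp.
have w0 : w != 0 by apply: contraNneq s0 => w0; move: sw;
  rewrite w0 eqmx0 submx0.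
by apply/eqP; apply: sub_dot su; apply: submx_trans xw _; rewrite sub_rV_sym.
Qed.

(** With a third scalar, x is kept off v by making it non-orthogonal to some c orthogonal to v. In
    dimension above 3, x can instead be moved along a vector orthogonal to all three [w]s. *)
Lemma avoid_point w1 w2 w3 v : has_third_scalar F \/ (3 < n)%N ->
  ~~ (w1 <= w3)%MS -> ~~ (w2 <= w3)%MS ->
  exists x, [/\ dot x w3 = 0, dot x w1 != 0, dot x w2 != 0 & ~~ (x <= v)%MS].
Proof.
move=> Fn w13 w23; case: Fn => [Fb|n_gt3].
  have [c cv cw3] := orth1 v n_gt2 w3.
  have [x xw3 /and3P[xw1 xw2 xc]] := cover3 Fb w13 w23 cw3.
  exists x; split=> //; first exact: xw3.
  by apply: contraNN xc => xv; rewrite (sub_dot xv) // dotC.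
have [x xw3 /andP[xw1 xw2]] := cover2 w13 w23.
have [s s0 [sw1 sw2 sw3]] := orth3 w1 w2 w3 n_gt3.
case/orP: (sub_perturb v xw1 sw1 s0) => xv.
  by exists x; rewrite xw3.
by exists (x + s); rewrite !dotDl sw1 sw2 sw3 !addr0 xw3.
Qed.

(** The second alternative is shaped by the field of order 2: there a y orthogonal to neither u nor
    v is orthogonal to u + v, so y is sought in that hyperplane. *)
Lemma avoid_hyperplane u v w z :
    [/\ has_third_scalar F, u != 0, v != 0 & w != 0] \/
    [/\ (3 < n)%N, ~~ (u <= (u + v)%R)%MS & ~~ (w <= (u + v)%R)%MS] ->
  exists y, [/\ dot y u != 0, dot y v != 0, dot y w != 0 & ~~ (y <= z)%MS].
Proof.
case=> [[Fb u0 v0 w0]|[n_gt3 uv wv]].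
  have [||| y _ /and3P[yu yv yw]] := @cover3 _ _ _ (0 : 'M_n) u v w Fb;
    rewrite ?submx0 //.
  have [s s0 [su sv]] := orth2 u v n_gt2.
  have [a a0 yaw] := affine_neq0 (dot s w) Fb yw.
  have as0 : a *: s != 0 by rewrite scaler_eq0 negb_or a0.
  have asu : dot (a *: s) u = 0 by rewrite dotZl su mulr0.
  case/orP: (sub_perturb z yu asu as0) => yz; first by exists y.
  by exists (y + a *: s); rewrite !dotDl !dotZl su sv mulr0 !addr0.
have [y yuv /andP[yu yw]] := cover2 uv wv.
have yv : dot y v != 0.
  apply: contraNneq yu => yv; have := yuv _ (submx_refl _).
  by rewrite dotDr yv addr0 => ->.
have [s s0 [su sv sw]] := orth3 u v w n_gt3.
case/orP: (sub_perturb z yu su s0) => yz; first by exists y.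
by exists (y + s); rewrite !dotDl su sv sw !addr0.
Qed.

(** This bounds the double perp of two antiflags with common point v. A q other than v is excluded
    by a hyperplane through v but not q, and a k outside the pencil of w1 and w2 by a point on w1
    and w2 but not on k. *)
Lemma dperp_sub v w1 w2 q k : dot v w1 != 0 -> dot v w2 != 0 ->
  (forall x y, dot x y != 0 -> dot x w1 = 0 -> dot x w2 = 0 -> dot v y = 0 ->
     dot x k = 0 /\ dot q y = 0) ->
  (q <= v)%MS /\ (k <= w1 + w2)%MS.
Proof.
move=> vw1 vw2 H; split; apply: contraT.
  move=> qv; have [x x0 [xw1 xw2]] := orth2 w1 w2 n_gt2.
  have xv : ~~ (x <= v)%MS.
    apply: contraNN vw1 => xv; apply/eqP; apply: sub_dot xw1.
    by rewrite -sub_rV_sym // (dot_neq0 vw2).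
  have [y yv /andP[yq]] := cover2 qv xv.
  rewrite dotC => /H[] //; first by rewrite dotC yv.
  by move=> _ /eqP; rewrite dotC (negPf yq).
move=> /sep_row[x xw xk].
have xw1 := xw _ (addsmxSl _ _); have xw2 := xw _ (addsmxSr _ _).
have x0 := (dot_neq0 xk).1.
have xv : ~~ (x <= v)%MS.
  apply: contraNN vw1 => xv; apply/eqP; apply: sub_dot xw1.
  by rewrite -sub_rV_sym // (dot_neq0 vw2).
have [y yv] := sep_row xv.
rewrite dotC => /H[] //; first by rewrite dotC yv.
by move/eqP; rewrite (negPf xk).
Qed.

(** For A = (v1, w1) and B = (v2, w2), the antiflag C = (q, w1) lies in the double perp of {A, B},
    while (x, y) shows that B is not in the double perp of {A, C}. *)
Lemma line_third_point v1 w1 v2 w2 :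
    dot v1 w1 != 0 -> ~~ (v1 <= v2)%MS -> ~~ (w1 <= w2)%MS -> v2 != 0 ->
      w2 != 0 ->
  exists q, [/\ dot q w1 != 0, ~~ (q <= v1)%MS,
    forall y, dot v1 y = 0 -> dot v2 y = 0 -> dot q y = 0 &
    exists x y, [/\ dot x y != 0, dot x w1 = 0, dot v1 y = 0, dot q y = 0 &
      dot x w2 != 0]].
Proof.
move=> v1w1 v12 w12 v20 w20; have [v10 w10] := dot_neq0 v1w1.
have v21 : ~~ (v2 <= v1)%MS by rewrite -sub_rV_sym.
have w21 : ~~ (w2 <= w1)%MS by rewrite -sub_rV_sym.
have [q [qw1 qv1 qy]] : exists q, [/\ dot q w1 != 0, ~~ (q <= v1)%MS &
    forall y, dot v1 y = 0 -> dot v2 y = 0 -> dot q y = 0].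
  (* The point q must lie off w1; v2 does unless it is on w1, and then v1 + v2 does because v1 is
     off w1. *)
  have [v2w1|v2w1] := eqVneq (dot v2 w1) 0; last by exists v2.
  exists (v1 + v2); rewrite dotDl v2w1 addr0; split=> //.
    apply: contraNN v21 => v12s; rewrite -(addKr v1 v2) addmx_sub //.
    by rewrite eqmx_opp.
  by move=> y v1y v2y; rewrite dotDl v1y v2y addr0.
exists q; split=> //.
have [y y0 [yv1 yv2]] := orth2 v1 v2 n_gt2.
have yw1 : ~~ (y <= w1)%MS.
  apply: contraNN v1w1 => yw1; rewrite dotC; apply/eqP; apply: sub_dot yv1.
  by rewrite -sub_rV_sym.
have [x xw1 /andP[xy xw2]] := cover2 yw1 w21.
exists x, y; split=> //; first exact: xw1.
  by rewrite dotC.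
by apply: qy; rewrite dotC.
Qed.

(** The relation ~4 in coordinates. *)
Definition generic v w v' w' :=
  [&& ~~ (v <= v')%MS, ~~ (w <= w')%MS, dot v w' != 0 & dot v' w != 0].

Lemma generic_swap v w v' w' : generic v w v' w' = generic w v w' v'.
Proof.
by rewrite /generic andbCA (dotC v) (dotC v'); do 2!congr (_ && _);
  rewrite andbC.
Qed.

Definition only01 := forall t : F, t = 0 \/ t = 1.

Lemma only01_neq0 : only01 -> forall t, t != 0 -> t = 1.
Proof. by move=> F2 t; case: (F2 t) => -> //; rewrite eqxx. Qed.

Lemma only01_addxx : only01 -> forall t, t + t = 0.
Proof.
move=> F2 t; suff e : 1 + 1 = 0 :> F by rewrite -(mulr1 t) -mulrDr e mulr0.
case: (F2 (1 + 1)) => // /(congr1 (fun t => t - 1)).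
by rewrite addrK subrr => e; rewrite e addr0.
Qed.

Lemma only01_sub : only01 -> forall u v, (u <= v)%MS -> u != 0 -> u = v.
Proof.
move=> F2 u v /sub_rVP[t ->]; case: (F2 t) => ->; last by rewrite scale1r.
by rewrite scale0r eqxx.
Qed.

(* If K is neither H1 nor H2, a suitable point x of K spoils the inclusion of the
   common neighbours of (p1, H1) and (p2, H2) in the neighbours of (q, K). *)
Lemma avoid_antiflag v1 w1 v2 w2 k :
    has_third_scalar F \/ (3 < n)%N /\ only01 -> dot v1 w1 != 0 ->
      dot v2 w2 != 0 ->
    k != 0 -> ~~ (k <= w1)%MS -> ~~ (k <= w2)%MS ->
    ~~ ((v1 <= v2)%MS && (w1 <= w2)%MS) -> ~~ generic v1 w1 v2 w2 ->
  exists x y, [/\ dot x y != 0, generic x y v1 w1, generic x y v2 w2 & dot x k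
    = 0].
Proof.
move=> Fn; have Fn' : has_third_scalar F \/ (3 < n)%N by case: Fn => [|[]];
  [left|right].
have y_ex u v w z : u != 0 -> v != 0 -> w != 0 ->
    (only01 -> ~~ (u <= (u + v)%R)%MS /\ ~~ (w <= (u + v)%R)%MS) ->
    exists y, [/\ dot y u != 0, dot y v != 0, dot y w != 0 & ~~ (y <= z)%MS].
  move=> u0 v0 w0 uvw; apply: avoid_hyperplane.
  by case: Fn => [Fb|[n3 /uvw[]]]; [left|right].
have sub_sum u v : v != 0 -> u != 0 -> ~~ (u <= v)%MS -> ~~ (u <= (u + v)%R)%MS.
  move=> v0 u0; apply: contraNN => uuv.
  have uv0 : u + v != 0.
    by apply: contraNneq u0 => uv; move: uuv; rewrite uv eqmx0 submx0.
  rewrite sub_rV_sym // -(addKr u v) addmx_sub ?eqmx_opp //.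
  by rewrite -sub_rV_sym.
move=> v1w1 v2w2 k0 kw1 kw2.
have [[v10 w10] [v20 w20]] := (dot_neq0 v1w1, dot_neq0 v2w2).
have w1k : ~~ (w1 <= k)%MS by rewrite sub_rV_sym.
have w2k : ~~ (w2 <= k)%MS by rewrite sub_rV_sym.
have [v12 /= w12 _|v12 _] := boolP (v1 <= v2)%MS.
  have [x [xk xw1 xw2 xv1]] := avoid_point v1 Fn' w1k w2k.
  have xv2 : ~~ (x <= v2)%MS.
    by apply: contraNN xv1 => /submx_trans; apply; rewrite -sub_rV_sym.
  (* Common point. As c is orthogonal to w1, a y with y.c nonzero is not proportional to w1. Over
     the field of order 2 the choice of c also prevents x = v1 + c, so that y can miss v1, c and x
     at once. *)
  have [c cw1 cxv] := orth1 w1 n_gt2 (x + v1)%R.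
  have c0 : c != 0 by apply: contraNneq cxv => ->; apply: sub0mx.
  have cv1 : ~~ (v1 <= c)%MS.
    by apply: contraNN v1w1 => vc; rewrite (sub_dot vc).
  have x0 : x != 0 by case/dot_neq0: xw1.
  have [|y [yv yc yx yw2]] := y_ex v1 c x w2 v10 c0 x0.
    move=> F2; split; first exact: sub_sum.
    apply: contraNN cxv => /(only01_sub F2)/(_ x0) ->.
    rewrite addrAC (_ : v1 + v1 = 0) ?add0r //.
    by apply/rowP => i; rewrite !mxE only01_addxx.
  have yw1 : ~~ (y <= w1)%MS.
    by apply: contraNN yc => /sub_dot -> //; rewrite dotC.
  exists x, y; rewrite /generic dotC yx xv1 yw1 xw1 xv2 yw2 xw2 (dotC v1) yv;
    split=> //=.
  by rewrite dotC; apply: contraNN yv => /eqP vy;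
    rewrite dotC (sub_dot v12) // dotC.
have v21 : ~~ (v2 <= v1)%MS by rewrite -sub_rV_sym.
have [w12 _|w12] := boolP (w1 <= w2)%MS.
  (* Common hyperplane. As c is orthogonal to v2, an x with x.c nonzero is not proportional to
     v2. *)
  have [c cv2 ck] := orth1 v2 n_gt2 k.
  have [x [xk xw1 xc xv1]] := avoid_point v1 Fn' w1k ck.
  have xv2 : ~~ (x <= v2)%MS.
    by apply: contraNN xc => xv; rewrite (sub_dot xv) // dotC.
  have xw2 : dot x w2 != 0.
    apply: contraNneq xw1 => xw2; rewrite dotC; apply/eqP; apply: sub_dot w12 _.
    by rewrite dotC.
  have x0 : x != 0 by case/dot_neq0: xw1.
  have [|y [yv1 yv2 yx yw1]] := y_ex v1 v2 x w1 v10 v20 x0.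
    move=> F2; split; first exact: sub_sum.
    apply: contraNN xw2 => /sub_dot ->;
      rewrite ?eqxx // dotDl (only01_neq0 F2 v2w2).
    by rewrite (only01_neq0 F2 (t := dot v1 w2)) ?only01_addxx //;
      apply: contraNneq v1w1 => vw; rewrite dotC (sub_dot w12) // dotC.
  have yw2 : ~~ (y <= w2)%MS.
    by apply: contraNN yw1 => /submx_trans; apply; rewrite -sub_rV_sym.
  by exists x, y; rewrite /generic (dotC x y)
    yx xv1 yw1 xw1 xv2 yw2 xw2 !(dotC _ y) yv1 yv2.
have w21 : ~~ (w2 <= w1)%MS by rewrite -sub_rV_sym.
rewrite {1}/generic v12 w12 /= negb_and !negbK.
(* Points and hyperplanes are now distinct, so failure of ~4 is an incidence, by symmetry that of v2
   with w1. *)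
wlog v2w1 : v1 w1 v2 w2 v1w1 v2w2 kw1 kw2 v10 w10 v20 w20 w1k w2k v12 v21 w12
  w21 / dot v2 w1 = 0.
  move=> W /orP[] /eqP e; last by apply: (W v1 w1 v2 w2);
    rewrite // e eqxx orbT.
  have [|x [y [xy r1 r2 xk0]]] :=
    W v2 w2 v1 w1 v2w2 v1w1 kw2 kw1 v20 w20 v10 w10 w2k w1k v21 v12 w21 w12 e.
    by rewrite e eqxx orbT.
  by exists x, y.
move=> _; have [v1w2|v1w2] := eqVneq (dot v1 w2) 0.
  have [x [xk xw1 xw2 xv]] := avoid_point (v1 + v2) Fn' w1k w2k.
  have x0 : x != 0 by case/dot_neq0: xw1.
  have [|y [yv1 yv2 yx _]] := y_ex v1 v2 x 0 v10 v20 x0.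
    by move=> F2; split=> //; apply: sub_sum.
  exists x, y; rewrite /generic dotC yx xw1 xw2 !(dotC _ y)
    yv1 yv2 /= xk !andbT; split=> //; apply/andP; split.
  - by apply: contraNN xw2 => /sub_dot ->.
  - by apply: contraNN yv2 => /sub_dot -> //; rewrite dotC.
  - by apply: contraNN xw1 => /sub_dot ->.
  - by apply: contraNN yv1 => /sub_dot -> //; rewrite dotC.
have [x [xk xw1 xw2 xv1]] := avoid_point v1 Fn' w1k w2k.
have x0 : x != 0 by case/dot_neq0: xw1.
have [|y [yv1 yv2 yx yw2]] := y_ex v1 v2 x w2 v10 v20 x0.
  move=> F2; split; first exact: sub_sum.
  apply: contraNN xw2 => /sub_dot ->;
    rewrite ?eqxx // dotDl (only01_neq0 F2 v2w2).
  by rewrite (only01_neq0 F2 v1w2) only01_addxx.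
exists x, y; rewrite /generic dotC yx xw1 xw2 !(dotC _ y)
  yv1 yv2 xv1 yw2 /= xk !andbT; split=> //.
  by apply: contraNN yv2 => /sub_dot -> //; rewrite dotC.
by apply: contraNN xw1 => /sub_dot ->.
Qed.
End Selection.

(** * Four hyperplanes meeting every point with constant parity *)

Section Parity.
Local Open Scope ring_scope.
Variables (F : fieldType) (n : nat).
Hypothesis n_gt2 : (2 < n)%N.
Implicit Types (u v w x y z : 'rV[F]_n).

(** True when x lies on an odd number of the four hyperplanes. *)
Definition zero_parity w1 w2 w3 w4 x :=
  (dot x w1 == 0) (+) (dot x w2 == 0) (+) (dot x w3 == 0) (+) (dot x w4 == 0).

Definition paired w1 w2 w3 w4 :=
  [|| (w1 <= w2)%MS && (w3 <= w4)%MS, (w1 <= w3)%MS && (w2 <= w4)%MS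
    | (w1 <= w4)%MS && (w2 <= w3)%MS].

(** Otherwise some point lies on v only and another on neither, giving both parities. *)
Lemma zero_parity2 u v b : u != 0 -> v != 0 ->
  (forall x, x != 0 -> (dot x u == 0) (+) (dot x v == 0) = b) -> (u <= v)%MS.
Proof.
move=> u0 v0 H; apply: contraT => uv.
have [y yv yu] := sep_row uv.
have := H _ (dot_neq0 yu).1;
  rewrite (yv v) ?submx_refl // (negPf yu) eqxx => be.
have := @cover2 _ _ _ (0 : 'M_n) u v;
  rewrite !submx0 => /(_ u0 v0)[x _ /andP[xu xv]].
by have := H _ (dot_neq0 xu).1; rewrite (negPf xu) (negPf xv) -be.
Qed.

(* Otherwise the four hyperplanes are distinct. Some point lies on w1 only, so the
   parity is odd; hence a point x on w1 and w2 lies on just one of w3 and w4. A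
   vector missing that one, w1 and w2 can be moved along x to miss all four. *)
Lemma zero_parity_paired w1 w2 w3 w4 b : has_third_scalar F ->
    w1 != 0 -> w2 != 0 -> w3 != 0 -> w4 != 0 ->
    (forall x, x != 0 -> zero_parity w1 w2 w3 w4 x = b) ->
  paired w1 w2 w3 w4.
Proof.
move=> Fb w10 w20 w30 w40 H.
have eqd u v x : u != 0 -> v != 0 -> (u <= v)%MS ->
  (dot x u == 0) = (dot x v == 0).
  by move=> u0 v0 uv; rewrite !(dotC x); apply: sub_dot_eq0.
(* Two equal hyperplanes cancel from the parity and leave the case of two. *)
have [w12|w12] := boolP (w1 <= w2)%MS.
  apply/or3P/Or31; rewrite w12; apply: (zero_parity2 (b := b)) => // x x0.
  by rewrite -(H x x0) /zero_parity (eqd _ _ _ w10 w20 w12) addbb.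
have [w13|w13] := boolP (w1 <= w3)%MS.
  apply/or3P/Or32; rewrite w13; apply: (zero_parity2 (b := b)) => // x x0.
  rewrite -(H x x0) /zero_parity (eqd _ _ _ w10 w30 w13).
  by do 3!case: (_ == 0).
have [w14|w14] := boolP (w1 <= w4)%MS.
  apply/or3P/Or33; rewrite w14; apply: (zero_parity2 (b := b)) => // x x0.
  rewrite -(H x x0) /zero_parity (eqd _ _ _ w10 w40 w14).
  by do 3!case: (_ == 0).
have w21 : ~~ (w2 <= w1)%MS by rewrite -sub_rV_sym.
have w31 : ~~ (w3 <= w1)%MS by rewrite -sub_rV_sym.
have w41 : ~~ (w4 <= w1)%MS by rewrite -sub_rV_sym.
have Hb x : x != 0 -> zero_parity w1 w2 w3 w4 x.
  move=> x0; have [y yw /and3P[/negPf y2 /negPf y3 /negPf y4]] :=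
    cover3 Fb w21 w31 w41.
  have y0 : y != 0 by apply: contraFneq y2 => ->; rewrite dot0l.
  rewrite (H x x0) -(H y y0) /zero_parity y2 y3 y4 (yw w1) ?submx_refl //.
  by rewrite eqxx.
have [x x0 [xw1 xw2]] := orth2 w1 w2 n_gt2.
have avoid u v w : u != 0 -> v != 0 -> w != 0 ->
  exists z, [/\ dot z u != 0, dot z v != 0 & dot z w != 0].
  move=> u0 v0 w0; have [|z []] := @avoid_hyperplane F n n_gt2 u v w 0;
    first by left.
  by exists z.
have key u v : dot x u = 0 -> dot x v != 0 -> u != 0 ->
    exists z, [&& dot z w1 != 0, dot z w2 != 0, dot z u != 0 & dot z v != 0].
  move=> xu xv u0; have [z [z1 z2 zu]] := avoid _ _ _ w10 w20 u0.
  have [zv|zv] := eqVneq (dot z v) 0; last by exists z; rewrite z1 z2 zu.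
  by exists (z + x); rewrite !dotDl xw1 xw2 xu zv !addr0 add0r z1 z2 zu.
have := Hb x x0; rewrite /zero_parity xw1 xw2 eqxx /=.
have [x3|x3] := eqVneq (dot x w3) 0;
  have [x4|x4] := eqVneq (dot x w4) 0 => //= _.
  have [z /and4P[z1 z2 z3 z4]] := key _ _ x3 x4 w30.
  by have := Hb z (dot_neq0 z1).1;
    rewrite /zero_parity !(negPf z1, negPf z2, negPf z3, negPf z4).
have [z /and4P[z1 z2 z4 z3]] := key _ _ x4 x3 w40.
by have := Hb z (dot_neq0 z1).1;
  rewrite /zero_parity !(negPf z1, negPf z2, negPf z3, negPf z4).
Qed.

(** One side of the equation depends on x only and the other on y only. Any two points miss a common
    hyperplane, and dually, so both sides are constant. *)
Lemma even_parity_paired v1 w1 v2 w2 v3 w3 v4 w4 : has_third_scalar F ->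
    dot v1 w1 != 0 -> dot v2 w2 != 0 -> dot v3 w3 != 0 -> dot v4 w4 != 0 ->
    (forall x y, dot x y != 0 ->
       zero_parity w1 w2 w3 w4 x = zero_parity v1 v2 v3 v4 y) ->
  paired w1 w2 w3 w4 /\ paired v1 v2 v3 v4.
Proof.
move=> Fb d1 d2 d3 d4.
have [[[v10 w10] [v20 w20]] [[v30 w30] [v40 w40]]] :=
  ((dot_neq0 d1, dot_neq0 d2), (dot_neq0 d3, dot_neq0 d4)).
have const (h k : 'rV[F]_n -> bool) : (forall x y, dot x y != 0 -> h x = k y) ->
    forall x x', x != 0 -> x' != 0 -> h x = h x'.
  move=> H x x' x0 x'0.
  have := @cover2 _ _ _ (0 : 'M_n) x x';
    rewrite !submx0 => /(_ x0 x'0)[y _ /andP[]].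
  by rewrite !(dotC y) => /H e /H e'; rewrite e e'.
move=> H; split.
  apply: (zero_parity_paired (b := zero_parity w1 w2 w3 w4 v1)) => // x x0.
  exact: const H _ _ x0 v10.
apply: (zero_parity_paired (b := zero_parity v1 v2 v3 v4 v1)) => // y y0.
by apply: (const _ (zero_parity w1 w2 w3 w4)) => // x z xz;
  rewrite (H z x) // dotC.
Qed.
End Parity.

(** * Common ~4-neighbours over the field of order 2 *)

Section OrderTwo.
Local Open Scope ring_scope.
Variables (F : fieldType) (n : nat).
Hypothesis F2 : only01 F.
Implicit Types (u v w x y z : 'rV[F]_n).

Lemma only01_addvv v : v + v = 0.
Proof. by apply/rowP => i; rewrite !mxE only01_addxx. Qed.

Lemma only01_subE u v : u != 0 -> v != 0 -> (u <= v)%MS = (u == v).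
Proof. by move=> u0 v0; apply/idP/eqP => [/(only01_sub F2)/(_ u0)|->]. Qed.

Lemma only01_add_eq0 u v : (u + v == 0) = (u == v).
Proof. by rewrite -(inj_eq (addIr v)) -addrA only01_addvv addr0 add0r. Qed.

Lemma rank_pair u v : u != 0 -> v != 0 -> u != v -> \rank (u + v)%MS = 2.
Proof.
move=> u0 v0 uv; apply/eqP; rewrite eqn_leq; apply/andP; split.
  by apply: leq_trans (mxrank_adds_leqif u v) _; rewrite !rank_rV u0 v0.
have : (u < u + v)%MS.
  rewrite /ltmx addsmxSl /=; apply/negP => /(submx_trans (addsmxSr u v)).
  by rewrite only01_subE // eq_sym (negPf uv).
by move/rank_ltmx; rewrite rank_rV u0.
Qed.

(* Put s = v + x, t = w + y and t' = w' + y: then t and t' are nonzero vectors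
   orthogonal to the plane <x, s> of F^3, hence equal. *)
Lemma common_generic_dot v w v' w' x y : (n < 4)%N -> dot v w != 0 ->
  dot v' w' != 0 ->
    dot x y != 0 -> generic x y v w -> generic x y v' w' ->
  dot v w' != 0 -> w = w'.
Proof.
move=> n_lt4 vw v'w' xy.
have [[[v0 w0] [v'0 w'0]] [x0 y0]] := (dot_neq0 vw, dot_neq0 v'w', dot_neq0 xy).
rewrite /generic !only01_subE // => /and4P[xv yw xw vy]
  /and4P[xv' yw' xw' v'y] vw'.
apply/eqP; apply: contraT => ww'.
have d1 u z : dot u z != 0 -> dot u z = 1 by apply: only01_neq0.
have s0 : v + x != 0 by rewrite only01_add_eq0 eq_sym.
have t0 : w + y != 0 by rewrite only01_add_eq0 eq_sym.
have t'0 : w' + y != 0 by rewrite only01_add_eq0 eq_sym.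
have xs : x != v + x by rewrite -subr_eq0 opprD addrCA subrr addr0 oppr_eq0.
have tt' : w + y != w' + y by rewrite (inj_eq (addIr y)).
have orth z : z \in [:: w + y; w' + y] -> (dot x z = 0) * (dot (v + x) z = 0).
  have e := (d1 _ _ vw, d1 _ _ xw, d1 _ _ xw', d1 _ _ vy, d1 _ _ xy, d1 _ _
    vw').
  by rewrite !inE => /orP[]/eqP->;
    rewrite !(dotDl, dotDr) !e !(only01_addxx F2) ?addr0.
have mul0 u z : dot u z = 0 -> u *m z^T = 0.
  by move=> uz; apply/eqP; rewrite mx11_eq0; apply/eqP.
have : col_mx x (v + x) *m (col_mx (w + y) (w' + y))^T = 0.
  rewrite tr_col_mx mul_col_mx !mul_mx_row !mul0 ?orth ?inE ?eqxx ?orbT //.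
  by rewrite !row_mx0 col_mx0.
move/mulmx0_rank_max; rewrite mxrank_tr -!addsmxE !rank_pair //.
by rewrite leqNgt n_lt4.
Qed.

(** A non-incidence forces equal hyperplanes by [common_generic_dot] and equal points by its dual,
    against distinctness. *)
Lemma common_generic v w v' w' x y : (n < 4)%N -> dot v w != 0 ->
  dot v' w' != 0 ->
    dot x y != 0 -> generic x y v w -> generic x y v' w' ->
      (v != v') || (w != w') ->
  dot v w' = 0 /\ dot v' w = 0.
Proof.
move=> n_lt4 vw v'w' xy r r' /negP ne.
have dual v1 w1 v2 w2 : dot v1 w1 != 0 -> dot v2 w2 != 0 ->
    generic x y v1 w1 -> generic x y v2 w2 -> dot v1 w2 != 0 -> v1 = v2.
  move=> d1 d2 r1 r2 d; apply/esym.
  apply: (@common_generic_dot w2 v2 w1 v1 y x n_lt4); rewrite 1?dotC //.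
    by rewrite -generic_swap.
  by rewrite -generic_swap.
have w_eq := common_generic_dot n_lt4.
split; apply/eqP; apply: contraT => d; case: ne.
  have vv := dual _ _ _ _ vw v'w' r r' d;
    have ww := w_eq _ _ _ _ _ _ vw v'w' xy r r' d.
  by rewrite vv ww !eqxx.
have vv := dual _ _ _ _ v'w' vw r' r d;
  have ww := w_eq _ _ _ _ _ _ v'w' vw xy r' r d.
by rewrite vv ww !eqxx.
Qed.

(** Take s orthogonal to w and w', and t orthogonal to v and v' with s.t = 1. Then (v + v' + s, w +
    w' + t) is an antiflag because 1 + 1 + 1 = 1. *)
Lemma common_generic_ex v w v' w' : (2 < n)%N -> dot v w != 0 ->
  dot v' w' != 0 ->
  dot v w' = 0 -> dot v' w = 0 ->
  exists x y, [/\ dot x y != 0, generic x y v w & generic x y v' w'].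
Proof.
move=> n_gt2 vw v'w' vw' v'w.
have [s s0 [sw sw']] := orth2 w w' n_gt2.
have sv : ~~ (s <= v + v')%MS.
  apply: contraNN s0 => /sub_addsmxP[[D E] /=].
  rewrite [D]mx11_scalar [E]mx11_scalar !mul_scalar_mx => sE.
  move: sw sw'; rewrite sE !dotDl !dotZl vw' v'w !mulr0 addr0 add0r.
  move/eqP; rewrite mulf_eq0 (negPf vw) orbF => /eqP->.
  by move/eqP; rewrite mulf_eq0 (negPf v'w') orbF => /eqP->;
    rewrite !scale0r addr0.
have [t tv ts] := sep_row sv.
have [tv1 tv2] := (tv _ (addsmxSl _ _), tv _ (addsmxSr _ _)).
have d1 u z : dot u z != 0 -> dot u z = 1 by apply: only01_neq0.
have e : [/\ dot v w = 1, dot v' w' = 1 & dot s t = 1].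
  by split; apply: d1; rewrite // dotC.
case: e => e1 e2 e3.
have xy : dot (v + v' + s) (w + w' + t) = 1.
  rewrite !(dotDl, dotDr) e1 e2 e3 vw' v'w sw sw' (dotC v t) (dotC v' t)
    tv1 tv2.
  by rewrite !addr0 !add0r only01_addxx // add0r.
exists (v + v' + s), (w + w' + t); rewrite xy oner_eq0.
have xw : dot (v + v' + s) w = 1 by rewrite !dotDl e1 v'w sw !addr0.
have xw' : dot (v + v' + s) w' = 1 by rewrite !dotDl e2 vw' sw' addr0 add0r.
have vy : dot v (w + w' + t) = 1 by rewrite !dotDr e1 vw' (dotC v t) tv1 !addr0.
have v'y : dot v' (w + w' + t) = 1
  by rewrite !dotDr e2 v'w (dotC v' t) tv2 addr0 add0r.
split=> //; rewrite /generic ?xw ?vy ?xw' ?v'y oner_eq0 /= andbT; apply/andP;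
  split.
- by apply: contraTN isT => /sub_dot/(_ vw'); rewrite xw' => /eqP;
    rewrite oner_eq0.
- apply: contraTN isT => /sub_dot h; have := h v';
    rewrite dotC v'w => /(_ erefl).
  by rewrite dotC v'y => /eqP; rewrite oner_eq0.
- by apply: contraTN isT => /sub_dot/(_ v'w); rewrite xw => /eqP;
    rewrite oner_eq0.
- apply: contraTN isT => /sub_dot h; have := h v;
    rewrite dotC vw' => /(_ erefl).
  by rewrite dotC vy => /eqP; rewrite oner_eq0.
Qed.
End OrderTwo.

(** * Coordinates of antiflags *)

Section Coordinates.
Local Open Scope ring_scope.
Variables (F : fieldType) (n : nat).
Implicit Types (u v w x y z : 'rV[F]_n) (A B C X : antiflag F n).

Definition perp w : {vspace 'rV[F]_n} := lker (linfun (mulmxr w^T)).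

Lemma mem_perp x w : (x \in perp w) = (dot x w == 0).
Proof. by rewrite memv_ker lfunE /= mx11_eq0. Qed.

Lemma dim_perp w : w != 0 -> \dim (perp w) = n.-1.
Proof.
move=> w0; set f := linfun (mulmxr w^T) : 'Hom('rV[F]_n, 'rV[F]_1).
have := limg_ker_dim f fullv;
  rewrite capfv dimvf (mul1n n : dim 'rV[F]_n = n) -/(perp w).
have le1 : (\dim (limg f) <= 1)%N.
  by apply: leq_trans (dimvS (subvf _)) _; rewrite dimvf.
have gt0 : (0 < \dim (limg f))%N.
  rewrite lt0n dimv_eq0 -lkerE; apply/negP => /subvP H.
  have [y yw] := sep0 w0; have := H y (memvf _).
  by rewrite mem_perp (negPf yw).
have -> : \dim (limg f) = 1%N by apply/eqP; rewrite eqn_leq le1.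
by rewrite addn1 => /(congr1 predn).
Qed.

(** A vector orthogonal to a basis of H but not to v is a normal vector of H, by equality of
    dimensions. *)
Lemma hyperplane_perp (H : {vspace 'rV[F]_n}) v :
  \dim H = n.-1 -> v \notin H -> exists2 w, H = perp w & dot v w != 0.
Proof.
move=> dH vH; pose M := \matrix_(i < \dim H) (vbasis H)`_i.
have vM : ~~ (v <= M)%MS.
  apply: contraNN vH => /submxP[D ->]; rewrite mulmx_sum_row;
    apply: memv_suml => i _.
  by rewrite rowK memvZ // vbasis_mem // mem_nth ?size_tuple.
have [w wM wv] := sep_row vM.
exists w; last by rewrite dotC.
apply/eqP; rewrite eqEdim dim_perp ?dH ?(dot_neq0 wv).1 // leqnn andbT.
rewrite -(span_basis (vbasisP H)); apply/span_subvP => u /(nthP 0)[i].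
rewrite size_tuple => iH <-; rewrite mem_perp dotC; apply/eqP/wM.
by have := row_sub (Ordinal iH) M; rewrite rowK.
Qed.

(** Coordinates are unique only up to a scalar on each vector, hence a relation and not a
    function. *)
Definition rep A (vw : 'rV[F]_n * 'rV[F]_n) :=
  [&& dot vw.1 vw.2 != 0, pt A == <[vw.1]>%VS & hyp A == perp vw.2].

Lemma rep_exists A : exists vw, rep A vw.
Proof.
have /and3P[/eqP/= dp /eqP/= dH npH] : is_antiflag (pt A, hyp A).
  by have := valP A; rewrite /pt /hyp; case: (val A).
set p := pt A in dp npH *; set v := vpick p.
have v0 : v != 0 by rewrite vpick0 -dimv_eq0 dp.
have pE : p = <[v]>%VS.
  apply/esym/eqP; rewrite eqEdim dp dim_vline v0 andbT -memvE.
  exact: memv_pick.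
have vH : v \notin hyp A by rewrite memvE -pE.
have [w HE vw] := hyperplane_perp dH vH.
by exists (v, w); rewrite /rep vw /= -pE -HE !eqxx.
Qed.

Lemma rep_antiflag v w : dot v w != 0 -> exists A, rep A (v, w).
Proof.
move=> vw; have [v0 w0] := dot_neq0 vw.
have pH : is_antiflag (<[v]>%VS, perp w).
  by rewrite /is_antiflag /is_point /is_hyperplane /= dim_vline v0 dim_perp //
    -memvE mem_perp vw !eqxx.
by exists (exist (fun vH => is_true (is_antiflag vH)) _ pH);
  rewrite /rep vw /pt /hyp /= !eqxx.
Qed.

Lemma line_subE u v : (<[u]> <= <[v]>)%VS = (u <= v)%MS.
Proof. by rewrite -memvE; apply/vlineP/sub_rVP. Qed.

Lemma line_eqE u v : u != 0 -> v != 0 -> (<[u]>%VS == <[v]>%VS) = (u <= v)%MS.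
Proof. by move=> u0 v0; rewrite eqEdim line_subE !dim_vline u0 v0 andbT. Qed.

Lemma perp_eqE u v : u != 0 -> v != 0 -> (perp u == perp v) = (u <= v)%MS.
Proof.
move=> u0 v0; rewrite eqEdim !dim_perp // leqnn andbT;
  apply/subvP/idP => [H|uv x].
  rewrite sub_rV_sym //; apply: contraT => /sep_row[y yu yv].
  by have := H y; rewrite !mem_perp yu ?submx_refl // eqxx (negPf yv) =>
    /(_ isT).
by rewrite !mem_perp !(dotC x) (sub_dot_eq0 _ u0 v0 uv).
Qed.

Section Pair.
Variables (A B : antiflag F n) (v w v' w' : 'rV[F]_n).
Hypotheses (rA : rep A (v, w)) (rB : rep B (v', w')).

Lemma rep_dot : dot v w != 0. Proof. by case/and3P: rA. Qed.

Lemma rep_inc : (pt A <= hyp B)%VS = (dot v w' == 0).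
Proof.
case/and3P: rA => _ /eqP-> _; case/and3P: rB => _ _ /eqP->.
by rewrite -memvE mem_perp.
Qed.

Lemma rep_pt : (pt A == pt B) = (v <= v')%MS.
Proof.
case/and3P: rA => /dot_neq0[v0 _] /eqP-> _.
by case/and3P: rB => /dot_neq0[v'0 _] /eqP-> _; rewrite line_eqE.
Qed.

Lemma rep_hyp : (hyp A == hyp B) = (w <= w')%MS.
Proof.
case/and3P: rA => /dot_neq0[_ w0] _ /eqP->.
by case/and3P: rB => /dot_neq0[_ w'0] _ /eqP->; rewrite perp_eqE.
Qed.
End Pair.

Lemma antiflag_eqE A B : (A == B) = (pt A == pt B) && (hyp A == hyp B).
Proof. by rewrite -val_eqE /pt /hyp; case: (val A) (val B) => p H [p' H']. Qed.

Lemma antiflag_inc A : ~~ (pt A <= hyp A)%VS.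
Proof. by case/and3P: (valP A). Qed.

Lemma sim1_incE A B : sim1 A B = (pt A <= hyp B)%VS (+) (pt B <= hyp A)%VS.
Proof.
rewrite /sim1; have [<-|_] /= := eqVneq A B; first by rewrite addbb.
by case: (_ <= _)%VS; case: (_ <= _)%VS.
Qed.

Lemma sim2_incE A B : sim2 A B = (pt A <= hyp B)%VS && (pt B <= hyp A)%VS.
Proof.
rewrite /sim2; have [<-|//] /= := eqVneq A B.
by rewrite (negPf (antiflag_inc _)).
Qed.

Lemma sim4_incE A B :
  sim4 A B = [&& pt A != pt B, hyp A != hyp B, ~~ (pt A <= hyp B)%VS & ~~ (pt B
    <= hyp A)%VS].
Proof. by rewrite /sim4; have [<-|//] /= := eqVneq A B; rewrite eqxx. Qed.

Lemma sim3_incE A B : sim3 A B = (pt A == pt B) (+) (hyp A == hyp B).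
Proof.
rewrite /sim3 antiflag_eqE.
by case: (pt A == pt B); case: (hyp A == hyp B).
Qed.

Lemma rep_sim4 A B v w v' w' : rep A (v, w) -> rep B (v', w') ->
  sim4 A B = generic v w v' w'.
Proof.
move=> rA rB; rewrite sim4_incE (rep_inc rA rB) (rep_inc rB rA).
by rewrite (rep_pt rA rB) (rep_hyp rA rB).
Qed.
End Coordinates.

(** * Invariants of a relation *)

Section Recover.
Variable T : eqType.
Implicit Types (R S : rel T) (P : T -> T -> Prop).

(** One-directional invariance suffices, since it applies to the inverse bijection too. *)
Lemma recover_by R S P :
    (forall f, bijective f -> {mono f : x y / R x y} -> forall x y, P x y ->
      P (f x) (f y)) ->
    (forall x y, P x y <-> S x y) -> recoverable R S.
Proof.
move=> Pf PS f bf fR x y; have [g fK gK] := bf.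
have bg : bijective g by exists f.
have gR : {mono g : x y / R x y} by move=> a b;
  rewrite -{2}(gK a) -{2}(gK b) fR.
apply/idP/idP => /PS h; apply/PS; last exact: Pf.
by rewrite -(fK x) -(fK y); apply: Pf.
Qed.

Lemma recoverable_trans R S U : recoverable R S -> recoverable S U ->
  recoverable R U.
Proof. by move=> RS SU f bf fR; apply: SU => //; apply: RS. Qed.

Definition dperp R a b c := forall x, R x a -> R x b -> R x c.

Lemma dperp_mono R f a b c : bijective f -> {mono f : x y / R x y} ->
  dperp R (f a) (f b) (f c) <-> dperp R a b c.
Proof.
move=> [g fK gK] fR; split=> H x;
  first by rewrite -(fR x a) -(fR x b) -(fR x c); apply: H.
by rewrite -(gK x) !fR; apply: H.
Qed.

Definition collinear2 R a b :=
  a <> b /\ forall c, c <> a -> dperp R a b c -> dperp R a c b.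

Lemma collinear2_bij R f : bijective f -> {mono f : x y / R x y} ->
  forall a b, collinear2 R a b -> collinear2 R (f a) (f b).
Proof.
move=> bf fR a b [ab H]; have [g fK gK] := bf; have inj := bij_inj bf.
split=> [/inj//|c]; rewrite -(gK c) => ca /dperp_mono h; apply/dperp_mono => //.
by apply: H; [move=> e; apply: ca; rewrite e | apply: h].
Qed.

Definition collinear4 R a c :=
  a <> c /\ exists b, [/\ b <> a, b <> c, ~~ R a b & dperp R a b c].

Lemma collinear4_bij R f : bijective f -> {mono f : x y / R x y} ->
  forall a b, collinear4 R a b -> collinear4 R (f a) (f b).
Proof.
move=> bf fR a c [ac [b [ba bc Rab H]]]; have inj := bij_inj bf.
split=> [/inj//|]; exists (f b); split=> [/inj//|/inj//||]; first by rewrite fR.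
exact/dperp_mono.
Qed.

(** The equation says that every x is related to an even number of the four elements. *)
Definition even_quad R a b c d :=
  uniq [:: a; b; c; d] /\ forall x, R a x (+) R b x = R c x (+) R d x.

(** Two even quadruples with different remaining pairs tell a side of a rectangle from a
    diagonal. *)
Definition collinear1 R a b := exists c d c' d',
  [/\ even_quad R a b c d, even_quad R a b c' d', c' != c & c' != d].

Lemma even_quad_bij R f : bijective f -> {mono f : x y / R x y} ->
  forall a b c d, even_quad R a b c d -> even_quad R (f a) (f b) (f c) (f d).
Proof.
move=> bf fR a b c d [u H]; split.
  by rewrite -[[:: f a; _; _; _]]/(map f [:: a; b; c; d]) map_inj_uniq //;
    apply: bij_inj.
by case: bf => g fK gK x; rewrite -(gK x) !fR.
Qed.

Lemma collinear1_bij R f : bijective f -> {mono f : x y / R x y} ->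
  forall a b, collinear1 R a b -> collinear1 R (f a) (f b).
Proof.
move=> bf fR a b [c [d [c' [d' [q q' cc cd]]]]].
exists (f c), (f d), (f c'), (f d').
by split; rewrite ?(inj_eq (bij_inj bf)) //; apply: even_quad_bij.
Qed.

Definition common_nbr R a b := a <> b /\ exists x, R x a && R x b.

Lemma common_nbr_bij R f : bijective f -> {mono f : x y / R x y} ->
  forall a b, common_nbr R a b -> common_nbr R (f a) (f b).
Proof.
move=> bf fR a b [ab [x xab]]; split=> [/(bij_inj bf)//|].
by exists (f x); rewrite !fR.
Qed.
End Recover.

(** * Recovering ~3 from the other relations *)

Section Criteria.
Local Open Scope ring_scope.
Variables (F : fieldType) (n : nat).
Hypothesis n_gt2 : (2 < n)%N.
Implicit Types (u v w x y z : 'rV[F]_n) (A B C D X : antiflag F n).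

Lemma rep_sim2 A B v w v' w' : rep A (v, w) -> rep B (v', w') ->
  sim2 A B = (dot v w' == 0) && (dot v' w == 0).
Proof. by move=> rA rB; rewrite sim2_incE (rep_inc rA rB) (rep_inc rB rA). Qed.

Lemma rep_sim3 A B v w v' w' : rep A (v, w) -> rep B (v', w') ->
  sim3 A B = (v <= v')%MS (+) (w <= w')%MS.
Proof. by move=> rA rB; rewrite sim3_incE (rep_pt rA rB) (rep_hyp rA rB). Qed.

Lemma rep_eq A B v w v' w' : rep A (v, w) -> rep B (v', w') ->
  (A == B) = (v <= v')%MS && (w <= w')%MS.
Proof. by move=> rA rB; rewrite antiflag_eqE (rep_pt rA rB)
  (rep_hyp rA rB). Qed.

(** By [dperp_sub], q is the common point and k = a w1 + b w2. As (q, k) differs from (v1, w1), b is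
    nonzero, so a point on w1 and k is on w2. *)
Lemma dperp_exchange v1 w1 v2 w2 q k :
    dot v1 w1 != 0 -> dot v2 w2 != 0 -> (v1 <= v2)%MS ->
    (forall x y, dot x y != 0 -> dot x w1 = 0 -> dot v1 y = 0 -> dot x w2 = 0 ->
       dot v2 y = 0 -> dot x k = 0 /\ dot q y = 0) ->
    k != 0 -> ~~ ((q <= v1)%MS && (k <= w1)%MS) ->
  forall x y, dot x w1 = 0 -> dot v1 y = 0 -> dot x k = 0 -> dot q y = 0 ->
    dot x w2 = 0 /\ dot v2 y = 0.
Proof.
move=> v1w1 v2w2 v12 H k0 qk.
have [[v10 w10] [v20 w20]] := (dot_neq0 v1w1, dot_neq0 v2w2).
have v21 : (v2 <= v1)%MS by rewrite -sub_rV_sym.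
have v1w2 : dot v1 w2 != 0 by rewrite (sub_dot_eq0 w2 v10 v20 v12).
have [|qv1 kw] := @dperp_sub F n n_gt2 v1 w1 w2 q k v1w1 v1w2.
  by move=> x y xy xw1 xw2 v1y; apply: H => //; apply: sub_dot v21 _.
move: qk; rewrite qv1 /=.
case/sub_addsmxP: kw => -[a b] /=;
  rewrite [a]mx11_scalar [b]mx11_scalar !mul_scalar_mx => -> kw1.
move=> x y xw1 v1y; rewrite dotDr !dotZr xw1 mulr0 add0r => /eqP.
rewrite mulf_eq0 => /orP[/eqP b0|/eqP xw2] _.
  by move: kw1; rewrite b0 scale0r addr0 scalemx_sub.
by split=> //; apply: sub_dot v21 _.
Qed.

Lemma collinear2P A B : collinear2 (@sim2 F n) A B <-> sim3 A B.
Proof.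
have [[[v1 w1] rA] [[v2 w2] rB]] := (rep_exists A, rep_exists B).
have [v1w1 v2w2] := (rep_dot rA, rep_dot rB).
have [[v10 w10] [v20 w20]] := (dot_neq0 v1w1, dot_neq0 v2w2).
split=> [[/eqP AB H]|].
  rewrite (rep_sim3 rA rB); move: AB; rewrite (rep_eq rA rB).
  have [//|v12] := boolP (v1 <= v2)%MS; have [//|w12 _] := boolP (w1 <= w2)%MS.
  have [q [qw1 qv1 qy [x [y [xy xw1 v1y qy0 xw2]]]]] :=
    line_third_point n_gt2 v1w1 v12 w12 v20 w20.
  have [C rC] := rep_antiflag qw1; have [X rX] := rep_antiflag xy.
  have CA : C <> A by apply/eqP; rewrite (rep_eq rC rA) negb_and qv1.
  have /H : dperp (@sim2 F n) A B C.
    move=> Y; have [[s t] rY] := rep_exists Y.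
    rewrite (rep_sim2 rY rA) (rep_sim2 rY rB) (rep_sim2 rY rC).
    by move=> /andP[-> /eqP v1t] /andP[_ /eqP v2t]; rewrite qy ?eqxx.
  move=> /(_ CA)/(_ X); rewrite (rep_sim2 rX rA) (rep_sim2 rX rB)
    (rep_sim2 rX rC).
  by rewrite xw1 v1y qy0 eqxx (negPf xw2) => /(_ isT isT).
move=> AB3; have AB : A <> B by move=> AB; move: AB3;
  rewrite AB sim3_incE !eqxx.
split=> // C CA H X; have [[[q k] rC] [[x y] rX]] :=
  (rep_exists C, rep_exists X).
rewrite (rep_sim2 rX rA) (rep_sim2 rX rB) (rep_sim2 rX rC).
move=> /andP[/eqP xw1 /eqP v1y] /andP[/eqP xk /eqP qy].
have [q0 k0] := dot_neq0 (rep_dot rC).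
have {}CA : ~~ ((q <= v1)%MS && (k <= w1)%MS) by rewrite -(rep_eq rC rA);
  apply/eqP.
have {}H s t : dot s t != 0 -> dot s w1 = 0 -> dot v1 t = 0 -> dot s w2 = 0 ->
    dot v2 t = 0 -> dot s k = 0 /\ dot q t = 0.
  move=> st sw1 v1t sw2 v2t; have [Y rY] := rep_antiflag st.
  have := H Y; rewrite (rep_sim2 rY rA) (rep_sim2 rY rB) (rep_sim2 rY rC).
  by rewrite sw1 sw2 v1t v2t eqxx => /(_ isT isT)/andP[/eqP-> /eqP->].
move: AB3; rewrite (rep_sim3 rA rB).
have [v12 _|_ /= w12] := boolP (v1 <= v2)%MS.
  by have [-> ->] := dperp_exchange v1w1 v2w2 v12 H k0 CA xw1 v1y xk qy;
    rewrite eqxx.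
(* A common hyperplane becomes a common point when the two vectors of each antiflag are
   exchanged. *)
rewrite dotC in v1w1; rewrite dotC in v2w2; rewrite andbC in CA.
have {}H s t : dot s t != 0 -> dot s v1 = 0 -> dot w1 t = 0 -> dot s v2 = 0 ->
    dot w2 t = 0 -> dot s q = 0 /\ dot k t = 0.
  rewrite dotC !(dotC s) !(dotC _ t) => ts v1s tw1 v2s tw2.
  by have [] := H t s ts tw1 v1s tw2 v2s.
rewrite dotC in xw1; rewrite dotC in v1y; rewrite dotC in xk;
  rewrite dotC in qy.
have [yv2 w2x] := dperp_exchange v1w1 v2w2 w12 H q0 CA v1y xw1 qy xk.
by rewrite dotC w2x dotC yv2 eqxx.
Qed.

(** By [avoid_antiflag] the hyperplane of C is that of A or of B, and dually for the point. As C is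
    neither A nor B, it takes one of the two from A, and only one. *)
Lemma collinear4P A C : has_third_scalar F \/ (3 < n)%N /\ only01 F ->
  collinear4 (@sim4 F n) A C <-> sim3 A C.
Proof.
move=> Fn; have [[[v1 w1] rA] [[q k] rC]] := (rep_exists A, rep_exists C).
have [v1w1 qk] := (rep_dot rA, rep_dot rC).
have [[v10 w10] [q0 k0]] := (dot_neq0 v1w1, dot_neq0 qk).
split=> [[/eqP A_C [B [/eqP BA /eqP BC AB4 H]]]|].
  have [[v2 w2] rB] := rep_exists B; have v2w2 := rep_dot rB.
  have [v20 w20] := dot_neq0 v2w2.
  have v12w12 : ~~ ((v1 <= v2)%MS && (w1 <= w2)%MS)
    by rewrite -(rep_eq rA rB) eq_sym.
  move: AB4; rewrite (rep_sim4 rA rB) => AB4.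
  have {}H x y : dot x y != 0 -> generic x y v1 w1 -> generic x y v2 w2 ->
    generic x y q k.
    move=> xy; have [X rX] := rep_antiflag xy; have := H X.
    by rewrite (rep_sim4 rX rA) (rep_sim4 rX rB) (rep_sim4 rX rC).
  have kw : (k <= w1)%MS || (k <= w2)%MS.
    rewrite -[_ || _]negbK negb_or; apply/negP => /andP[kw1 kw2].
    have [x [y [xy r1 r2 xk]]] :=
      avoid_antiflag n_gt2 Fn v1w1 v2w2 k0 kw1 kw2 v12w12 AB4.
    by have /and4P[_ _ /negP[]] := H x y xy r1 r2; rewrite xk.
  have qv : (q <= v1)%MS || (q <= v2)%MS.
    rewrite -[_ || _]negbK negb_or; apply/negP => /andP[qv1 qv2].
    rewrite generic_swap in AB4; rewrite andbC in v12w12;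
      rewrite dotC in v1w1; rewrite dotC in v2w2.
    have [x [y [xy r1 r2 xq]]] :=
      avoid_antiflag n_gt2 Fn v1w1 v2w2 q0 qv1 qv2 v12w12 AB4.
    rewrite dotC in xy; rewrite !(generic_swap x) in r1 r2.
    by have /and4P[_ _ _ /negP[]] := H y x xy r1 r2; rewrite dotC xq.
  move: A_C BC; rewrite eq_sym (rep_eq rC rA) eq_sym (rep_eq rC rB)
    (rep_sim3 rA rC).
  rewrite (sub_rV_sym v10 q0) (sub_rV_sym w10 k0).
  by case: (q <= v1)%MS qv => /= [_|->]; case: (k <= w1)%MS kw => //= ->.
move=> AC3; have A_C : A <> C by move=> A_C; move: AC3;
  rewrite A_C sim3_incE !eqxx.
(* When C mixes A and B, the conditions for X ~4 C are among those for X ~4 A and X ~4 B. *)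
have conclude B : B <> A -> B <> C -> ~~ sim4 A B ->
    (pt A = pt C /\ hyp B = hyp C) \/ (pt B = pt C /\ hyp A = hyp C) ->
    collinear4 (@sim4 F n) A C.
  move=> BA BC AB4 e; split=> //; exists B; split=> // X.
  by case: e => -[e1 e2]; rewrite !sim4_incE e1 e2 => /and4P[? ? ? ?]
    /and4P[? ? ? ?]; apply/and4P.
move: AC3; rewrite sim3_incE; have [ptAC|ptAC] := eqVneq (pt A) (pt C);
  last first.
  move=> /= /eqP hypAC.
  have qv1 : ~~ (q <= v1)%MS by rewrite -sub_rV_sym // -(rep_pt rA rC).
  (* B gets the point of C and a hyperplane through the point of A, which rules out A ~4 B. *)
  have [y yv1 yq] := sep_row qv1.
  rewrite dotC in yq; have [B rB] := rep_antiflag yq.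
  have ptBC : pt B = pt C by apply/eqP; rewrite (rep_pt rB rC) submx_refl.
  have AB0 : (pt A <= hyp B)%VS by rewrite (rep_inc rA rB) dotC yv1 ?submx_refl.
  apply: (conclude B); last by right.
  - by move=> BA; move: ptAC; rewrite -ptBC BA eqxx.
  - by move=> BC; move: AB0; rewrite BC -hypAC (negPf (antiflag_inc A)).
  - by rewrite sim4_incE AB0 !andbF.
move=> /= hypAC.
have kw1 : ~~ (k <= w1)%MS by rewrite -sub_rV_sym // -(rep_hyp rA rC).
have [y yw1 yk] := sep_row kw1.
have [B rB] := rep_antiflag yk.
have hypBC : hyp B = hyp C by apply/eqP; rewrite (rep_hyp rB rC) submx_refl.
have BA0 : (pt B <= hyp A)%VS by rewrite (rep_inc rB rA) yw1 ?submx_refl.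
apply: (conclude B); last by left.
- by move=> BA; move: hypAC; rewrite -hypBC BA eqxx.
- by move=> BC; move: BA0; rewrite BC -ptAC (negPf (antiflag_inc A)).
- by rewrite sim4_incE BA0 !andbF.
Qed.

(** Each point and each hyperplane occurs twice among the corners, so all incidences with X
    cancel. *)
Lemma rectangle_even A B C D : A != B -> A != C ->
    [/\ pt A = pt B, pt C = pt D, hyp A = hyp C & hyp B = hyp D] \/
    [/\ hyp A = hyp B, hyp C = hyp D, pt A = pt C & pt B = pt D] ->
  even_quad (@sim1 F n) A B C D.
Proof.
move=> AB A_C e; split.
  move: AB A_C; rewrite /= !inE !antiflag_eqE.
  case: e => -[-> -> -> ->]; rewrite !eqxx ?(eq_sym (pt D)) ?(eq_sym (hyp D)).
    by case: (pt B == pt D); case: (hyp C == hyp D).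
  by case: (pt C == pt D); case: (hyp B == hyp D).
move=> X; rewrite !sim1_incE.
by case: e => -[-> -> -> ->]; do 4!case: (_ <= _)%VS.
Qed.

(** Parity pairs off the four points and the four hyperplanes. As A and B share neither, A is paired
    with C or D in both pairings, and not with the same one since the antiflags are distinct. *)
Lemma even_quad_opposite A B C D : has_third_scalar F ->
  even_quad (@sim1 F n) A B C D -> ~~ sim3 A B ->
  [/\ pt C = pt A, hyp C = hyp B, pt D = pt B & hyp D = hyp A] \/
  [/\ pt D = pt A, hyp D = hyp B, pt C = pt B & hyp C = hyp A].
Proof.
move=> Fb [uABCD H] AB3.
have [[[v1 w1] rA] [[v2 w2] rB]] := (rep_exists A, rep_exists B).
have [[[v3 w3] rC] [[v4 w4] rD]] := (rep_exists C, rep_exists D).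
have [] := even_parity_paired n_gt2 Fb (rep_dot rA) (rep_dot rB) (rep_dot rC)
  (rep_dot rD).
  move=> x y xy; have [X rX] := rep_antiflag xy.
  have := H X; rewrite !sim1_incE.
  rewrite (rep_inc rA rX) (rep_inc rB rX) (rep_inc rC rX) (rep_inc rD rX).
  rewrite (rep_inc rX rA) (rep_inc rX rB) (rep_inc rX rC) (rep_inc rX rD).
  rewrite /zero_parity !(dotC y).
  by do 8!case: (_ == 0).
rewrite /paired -(rep_pt rA rB) -(rep_pt rA rC) -(rep_pt rA rD).
rewrite -(rep_pt rC rD) -(rep_pt rB rD) -(rep_pt rB rC).
rewrite -(rep_hyp rA rB) -(rep_hyp rA rC) -(rep_hyp rA rD).
rewrite -(rep_hyp rC rD) -(rep_hyp rB rD) -(rep_hyp rB rC).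
move=> hypP ptP.
have distinct X : X \in [:: B; C;
  D] -> (pt A == pt X) && (hyp A == hyp X) = false.
  move=> XBCD; apply: contraTF uABCD; rewrite -antiflag_eqE => /eqP->.
  by rewrite cons_uniq XBCD.
have AB : (pt A == pt B) && (hyp A == hyp B) = false by apply: distinct;
  rewrite mem_head.
have A_C : (pt A == pt C) && (hyp A == hyp C) = false.
  by apply: distinct; rewrite in_cons mem_head orbT.
have AD : (pt A == pt D) && (hyp A == hyp D) = false.
  by apply: distinct; rewrite -[[:: B; C; D]]/(rcons [:: B;
    C] D) mem_rcons mem_head.
have [ptAB hypAB] : (pt A == pt B) = false /\ (hyp A == hyp B) = false.
  move: AB3 AB; rewrite sim3_incE.
  by case: (pt A == pt B); case: (hyp A == hyp B).
move: hypP ptP; rewrite ptAB hypAB /=.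
move=> /orP[]/andP[/eqP h1 /eqP h2] /orP[]/andP[/eqP p1 /eqP p2].
- by move: A_C; rewrite h1 p1 !eqxx.
- by right; rewrite h1 h2 p1 p2.
- by left; rewrite h1 h2 p1 p2.
by move: AD; rewrite h1 p1 !eqxx.
Qed.

(** A diagonal determines the other two corners. A side with a common point is completed by any
    further point off both hyperplanes, and dually. *)
Lemma collinear1P A B : has_third_scalar F ->
  collinear1 (@sim1 F n) A B <-> sim3 A B.
Proof.
move=> Fb; split=> [[C [D [C' [D' [Q Q' C'C C'D]]]]]|].
  apply: contraT => AB3; move: C'C C'D; rewrite !antiflag_eqE.
  case: (even_quad_opposite Fb Q AB3) => -[-> -> -> ->];
    by case: (even_quad_opposite Fb Q' AB3) => -[e1 e2 e3 e4];
      rewrite ?e1 ?e2 ?e3 ?e4 !eqxx.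
have [[[v1 w1] rA] [[v2 w2] rB]] := (rep_exists A, rep_exists B).
have [[v10 w10] [v20 w20]] := (dot_neq0 (rep_dot rA), dot_neq0 (rep_dot rB)).
have pick u v w : u != 0 -> v != 0 -> w != 0 -> exists p p',
    [/\ [/\ dot p u != 0, dot p v != 0, dot p' u != 0 & dot p' v != 0],
       ~~ (p <= w)%MS, ~~ (p' <= w)%MS & ~~ (p' <= p)%MS].
  move=> u0 v0 w0; have Fb' : [/\ has_third_scalar F, u != 0, v != 0 & u != 0]
    by [].
  have [p [pu pv _ pw]] := avoid_hyperplane n_gt2 w (or_introl Fb').
  (* Non-orthogonality to c keeps p' off w, while p' also has to avoid p. *)
  have [c c0 [cw _]] := orth2 w w n_gt2.
  have {}Fb' : [/\ has_third_scalar F, u != 0, v != 0 & c != 0] by [].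
  have [p' [p'u p'v p'c p'p]] := avoid_hyperplane n_gt2 p (or_introl Fb').
  exists p, p'; split=> //; apply: contraNN p'c => p'w.
  by rewrite (sub_dot p'w) // dotC.
rewrite sim3_incE; have [ptAB /= hypAB|ptAB /= /eqP hypAB] :=
  eqVneq (pt A) (pt B).
  have [p [p' [[pu pv p'u p'v] pw p'w p'p]]] := pick _ _ _ w10 w20 v10.
  have [[C rC] [D rD]] := (rep_antiflag pu, rep_antiflag pv).
  have [[C' rC'] [D' rD']] := (rep_antiflag p'u, rep_antiflag p'v).
  have p0 := (dot_neq0 pu).1; have p'0 := (dot_neq0 p'u).1.
  have quad C0 D0 p0' : rep C0 (p0', w1) -> rep D0 (p0', w2) ->
    ~~ (v1 <= p0')%MS ->
      even_quad (@sim1 F n) A B C0 D0.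
    move=> rC0 rD0 v1p; apply: rectangle_even.
    - by rewrite antiflag_eqE negb_and hypAB orbT.
    - by rewrite (rep_eq rA rC0) (negPf v1p).
    left; split=> //; apply/eqP; first by rewrite (rep_pt rC0 rD0) submx_refl.
      by rewrite (rep_hyp rA rC0) submx_refl.
    by rewrite (rep_hyp rB rD0) submx_refl.
  exists C, D, C', D'; split.
  - by apply: quad rC rD _; rewrite sub_rV_sym.
  - by apply: quad rC' rD' _; rewrite sub_rV_sym.
  - by rewrite (rep_eq rC' rC) (negPf p'p).
  - by rewrite (rep_eq rC' rD) (negPf p'p).
have [p [p' [[pu pv p'u p'v] pw p'w p'p]]] := pick _ _ _ v10 v20 w10.
have p0 := (dot_neq0 pu).1; have p'0 := (dot_neq0 p'u).1.
rewrite dotC in pu; rewrite dotC in pv; rewrite dotC in p'u;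
  rewrite dotC in p'v.
have [[C rC] [D rD]] := (rep_antiflag pu, rep_antiflag pv).
have [[C' rC'] [D' rD']] := (rep_antiflag p'u, rep_antiflag p'v).
have quad C0 D0 p0' : rep C0 (v1, p0') -> rep D0 (v2, p0') ->
  ~~ (w1 <= p0')%MS ->
    even_quad (@sim1 F n) A B C0 D0.
  move=> rC0 rD0 v1p; apply: rectangle_even.
  - by rewrite antiflag_eqE negb_and ptAB.
  - by rewrite (rep_eq rA rC0) (negPf v1p) andbF.
  right; split=> //; apply/eqP; first by rewrite (rep_hyp rC0 rD0) submx_refl.
    by rewrite (rep_pt rA rC0) submx_refl.
  by rewrite (rep_pt rB rD0) submx_refl.
exists C, D, C', D'; split.
- by apply: quad rC rD _; rewrite sub_rV_sym.
- by apply: quad rC' rD' _; rewrite sub_rV_sym.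
- by rewrite (rep_eq rC' rC) (negPf p'p) andbF.
- by rewrite (rep_eq rC' rD) (negPf p'p) andbF.
Qed.

Lemma common_nbrP A B : only01 F -> (n < 4)%N ->
  common_nbr (@sim4 F n) A B <-> sim2 A B.
Proof.
move=> F2 n_lt4; have [[[v w] rA] [[v' w'] rB]] := (rep_exists A, rep_exists B).
have [vw v'w'] := (rep_dot rA, rep_dot rB).
have [[v0 w0] [v'0 w'0]] := (dot_neq0 vw, dot_neq0 v'w').
split=> [[/eqP AB [X]]|].
  have [[x y] rX] := rep_exists X.
  rewrite (rep_sim4 rX rA) (rep_sim4 rX rB) => /andP[r r'].
  have [|e e'] := common_generic F2 n_lt4 vw v'w' (rep_dot rX) r r'.
    by move: AB; rewrite (rep_eq rA rB) !only01_subE // negb_and.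
  by rewrite (rep_sim2 rA rB) e e' eqxx.
move=> AB2; have AB : A <> B.
  by move=> AB; move: AB2; rewrite AB sim2_incE (negPf (antiflag_inc B)).
split=> //; move: AB2; rewrite (rep_sim2 rA rB) => /andP[/eqP e /eqP e'].
have [x [y [xy r r']]] := common_generic_ex F2 n_gt2 vw v'w' e e'.
have [X rX] := rep_antiflag xy.
by exists X; rewrite (rep_sim4 rX rA) (rep_sim4 rX rB) r r'.
Qed.
End Criteria.

(** * Recovering the other relations from ~3 *)

Section FromCollinearity.
Variables (F : fieldType) (n : nat).
Implicit Types (A B X : antiflag F n).

Lemma mixed_exists A B : ~~ (pt A <= hyp B)%VS ->
  exists2 X, pt X = pt A & hyp X = hyp B.
Proof.
move=> AB; have pH : is_antiflag (pt A, hyp B).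
  apply/and3P; split=> //.
    by have /and3P[] := valP A.
  by have /and3P[] := valP B.
by exists (exist (fun vH => is_true (is_antiflag vH)) _ pH).
Qed.

(** As A and B share neither point nor hyperplane, X must take its point from one and its hyperplane
    from the other. *)
Lemma sim3_common A B X : A != B -> ~~ sim3 A B ->
  sim3 X A && sim3 X B = (pt X == pt A) && (hyp X == hyp B)
                      || (pt X == pt B) && (hyp X == hyp A).
Proof.
rewrite !sim3_incE antiflag_eqE.
have [-> |pA] := eqVneq (pt X) (pt A); have [-> |hA] := eqVneq (hyp X) (hyp A).
- by case: (pt A == pt B); case: (hyp A == hyp B).
- by case: (pt A == pt B); case: (hyp A == hyp B); case: (hyp X == hyp B).
- by case: (pt A == pt B); case: (hyp A == hyp B); case: (pt X == pt B).
by rewrite andbF.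
Qed.
End FromCollinearity.

Section FromSim3.
Variables (F : fieldType) (n : nat).
Implicit Types (A B X : antiflag F n).

Definition no_common_nbr (T : eqType) (R : rel T) a b :=
  [/\ a <> b, ~~ R a b & ~ exists x, R x a && R x b].

Definition two_common_nbrs (T : eqType) (R : rel T) a b :=
  [/\ a <> b, ~~ R a b & exists x y, [/\ x <> y, R x a && R x b & R y a && R y
    b]].

Lemma no_common_nbr_bij (T : eqType) (R : rel T) f : bijective f ->
  {mono f : x y / R x y} ->
  forall a b, no_common_nbr R a b -> no_common_nbr R (f a) (f b).
Proof.
move=> bf fR a b [ab Rab H]; split=> [/(bij_inj bf)//||[x]];
  first by rewrite fR.
by case: bf => g fK gK; rewrite -(gK x) !fR => h; apply: H; exists (g x).
Qed.

Lemma two_common_nbrs_bij (T : eqType) (R : rel T) f : bijective f ->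
  {mono f : x y / R x y} ->
  forall a b, two_common_nbrs R a b -> two_common_nbrs R (f a) (f b).
Proof.
move=> bf fR a b [ab Rab [x [y [xy xab yab]]]].
split=> [/(bij_inj bf)//||]; first by rewrite fR.
by exists (f x), (f y); rewrite !fR; split=> // /(bij_inj bf).
Qed.

Lemma eq_pt_inc A B : pt A = pt B ->
  (pt A <= hyp B)%VS = false /\ (pt B <= hyp A)%VS = false.
Proof.
by move=> e; split; apply/negbTE; [rewrite e|rewrite -e]; apply: antiflag_inc.
Qed.

Lemma eq_hyp_inc A B : hyp A = hyp B ->
  (pt A <= hyp B)%VS = false /\ (pt B <= hyp A)%VS = false.
Proof.
by move=> e; split; apply/negbTE; [rewrite -e|rewrite e]; apply: antiflag_inc.
Qed.

Lemma sim3_incF A B : sim3 A B ->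
  (pt A <= hyp B)%VS = false /\ (pt B <= hyp A)%VS = false.
Proof. by move=> /andP[_ /orP[/eqP/eq_pt_inc|/eqP/eq_hyp_inc]]. Qed.

(** The pair (pt A, hyp B) is an antiflag exactly when pt A is off hyp B, so both mixed pairs fail
    exactly when both incidences hold. *)
Lemma no_common_nbrP A B : no_common_nbr (@sim3 F n) A B <-> sim2 A B.
Proof.
rewrite sim2_incE; split=> [[/eqP AB AB3 H]|AB2].
  apply/andP; split; apply: contraT => /mixed_exists[X pX hX]; case: H;
    exists X.
    by rewrite sim3_common // pX hX !eqxx.
  by rewrite sim3_common // pX hX !eqxx orbT.
have AB : A <> B by move=> AB; move: AB2; rewrite AB (negPf (antiflag_inc B)).
have AB3 : ~~ sim3 A B by apply: contraTN AB2 => /sim3_incF[-> ->].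
split=> // -[X]; rewrite sim3_common //; last exact/eqP.
by case/orP => /andP[/eqP p /eqP h]; case/andP: AB2 => i j;
  have := antiflag_inc X; rewrite p h ?i ?j.
Qed.

Lemma two_common_nbrsP A B : two_common_nbrs (@sim3 F n) A B <-> sim4 A B.
Proof.
rewrite sim4_incE; split=> [[/eqP AB AB3 [X [Y [XY]]]]|].
  rewrite !sim3_common // => Xc Yc.
  have [pAB hAB] : (pt A != pt B) /\ (hyp A != hyp B).
    move: AB AB3; rewrite sim3_incE antiflag_eqE.
    by case: (pt A == pt B); case: (hyp A == hyp B).
  rewrite pAB hAB /=; have inc := antiflag_inc.
  have ne : ~ (pt X = pt Y /\ hyp X = hyp Y).
    by move=> [p h]; apply: XY; apply/eqP; rewrite antiflag_eqE p h !eqxx.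
  case/orP: Xc => /andP[/eqP pX /eqP hX];
    case/orP: Yc => /andP[/eqP pY /eqP hY].
  - by case: ne; rewrite pX hX pY hY.
  - by rewrite -{1}pX -hX inc -pY -hY inc.
  - by rewrite -{1}pY -hY inc -pX -hX inc.
  - by case: ne; rewrite pX hX pY hY.
case/and4P => pAB hAB /mixed_exists[X pX hX] /mixed_exists[Y pY hY].
have AB : A != B by rewrite antiflag_eqE negb_and pAB.
have AB3 : ~~ sim3 A B by rewrite sim3_incE (negPf pAB) (negPf hAB).
split=> //; first exact/eqP.
exists X, Y; rewrite !sim3_common // pX hX pY hY !eqxx orbT; split=> //.
by move=> XY; move: pAB; rewrite -pX -pY XY eqxx.
Qed.

(** The four relations partition the pairs of distinct antiflags, so ~1 is what the other three
    leave. *)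
Lemma sim1_simE A B : sim1 A B = [&& A != B, ~~ sim2 A B, ~~ sim3 A B & ~~ sim4
  A B].
Proof.
rewrite sim1_incE sim2_incE sim3_incE sim4_incE antiflag_eqE.
have [/eq_pt_inc[-> ->]|_] := eqVneq (pt A) (pt B).
  by case: (hyp A == hyp B).
have [/eq_hyp_inc[-> ->]|_] := eqVneq (hyp A) (hyp B) => //=.
by case: (pt A <= hyp B)%VS; case: (pt B <= hyp A)%VS.
Qed.

Lemma sim3_recovers j : 1 <= j <= 4 -> recoverable (@sim F n 3) (@sim F n j).
Proof.
have r2 : recoverable (@sim3 F n) (@sim2 F n).
  exact: recover_by (@no_common_nbr_bij _ _) no_common_nbrP.
have generic : recoverable (@sim3 F n) (@sim4 F n).
  exact: recover_by (@two_common_nbrs_bij _ _) two_common_nbrsP.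
case: j => [|[|[|[|[|j]]]]] //= _ f bf fR x y; last exact: fR.
by rewrite !sim1_simE (r2 f) // fR (generic f) // (inj_eq (bij_inj bf)).
Qed.
End FromSim3.

(** * Size of the field *)

Section Cardinality.
Local Open Scope ring_scope.
Variable F : fieldType.

Lemma card_ge3_third_scalar : card_ge F 3 -> has_third_scalar F.
Proof.
move=> [f finj]; have [/existsP[i fi]|/existsPn f01] :=
  boolP [exists i, (f i != 0) && (f i != 1)]; first by exists (f i).
have : (size (map f (enum 'I_3)) <= size [:: 0%R : F; 1%R])%N.
  apply: uniq_leq_size; first by rewrite map_inj_uniq ?enum_uniq.
  move=> t /mapP[i _ ->]; rewrite !inE.
  by have := f01 i; rewrite negb_and !negbK.
by rewrite size_map size_enum_ord.
Qed.

Lemma card_eq2_only01 : card_eq F 2 -> only01 F.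
Proof.
move=> [f [g fK gK]] t; have [|t0] := eqVneq t 0; first by left.
have [|t1] := eqVneq t 1; first by right.
have : (size (map g [:: 0%R; 1%R; t]) <= size (enum 'I_2))%N.
  apply: uniq_leq_size => [|i _]; last by rewrite mem_enum.
  rewrite map_inj_uniq; last exact: can_inj gK.
  by rewrite /= !inE !negb_or eq_sym oner_neq0 ![_ == t]eq_sym t0 t1.
by rewrite size_map size_enum_ord.
Qed.

(** For an arbitrary field the disjunction is asserted only up to double negation;
    [recoverable_classically] discharges it. *)
Lemma third_scalar_or_only01 : classically (has_third_scalar F \/ only01 F).
Proof.
move=> b H; apply: (@classic_EM (has_third_scalar F)) => -[Fb|nFb];
  first by apply: H; left.
apply: H; right=> t; have [|t0] := eqVneq t 0; first by left.
have [|t1] := eqVneq t 1; first by right.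
by case: nFb; exists t; rewrite t0.
Qed.
End Cardinality.

(** The conclusion is an equality of booleans, hence stable under double negation. *)
Lemma recoverable_classically (T : Type) (R S : rel T) :
  classically (recoverable R S) -> recoverable R S.
Proof.
by move=> H f bf fR x y; apply/eqP; apply: H => H; apply/eqP; apply: H.
Qed.

(** * Reflections over the field with two elements *)

Section Reflection.
Local Open Scope ring_scope.
Variables (F : fieldType) (n : nat).
Hypothesis F2 : only01 F.
Implicit Types (u v w x y z : 'rV[F]_n) (A B C X : antiflag F n).

Definition coords A := xchoose (rep_exists A).

Lemma coordsP A : rep A (coords A).
Proof. exact: xchooseP. Qed.

(** The only nonzero scalar is 1, so coordinates are unique. *)
Lemma rep_coords A v w : rep A (v, w) -> coords A = (v, w).
Proof.
move=> rA; have := coordsP A; case: (coords A) => v' w' rA'.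
have [[v0 w0] [v'0 w'0]] := (dot_neq0 (rep_dot rA), dot_neq0 (rep_dot rA')).
have := rep_pt rA' rA; have := rep_hyp rA' rA; rewrite !eqxx !only01_subE //.
by move=> /esym/eqP-> /esym/eqP->.
Qed.

Lemma rep_inj A B vw : rep A vw -> rep B vw -> A = B.
Proof.
case: vw => v w rA rB; apply/eqP.
by rewrite antiflag_eqE (rep_pt rA rB) (rep_hyp rA rB) !submx_refl.
Qed.

(** [A] is the default value, returned when the pair is not an antiflag. *)
Definition antiflag_of A v w : antiflag F n := insubd A (<[v]>%VS, perp w).

Lemma rep_antiflag_of A v w : dot v w != 0 -> rep (antiflag_of A v w) (v, w).
Proof.
move=> vw; have [B rB] := rep_antiflag vw; rewrite /antiflag_of.
have -> : (<[v]>%VS, perp w) = val B.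
  case/and3P: rB => _ /eqP p /eqP h; move: p h; rewrite /pt /hyp /=.
  by case: (val B) => p h /= -> ->.
by rewrite valKd.
Qed.

(** The polar form of the quadratic form (v, w) |-> v.w. *)
Definition bform (a b : 'rV[F]_n * 'rV[F]_n) := dot a.1 b.2 + dot b.1 a.2.

(** The orthogonal reflection a |-> a + B(a, c) c in the nonsingular vector c of [C]. *)
Definition refl C A :=
  let s := bform (coords A) (coords C) in
  antiflag_of A ((coords A).1 + s *: (coords C).1)
    ((coords A).2 + s *: (coords C).2).

(** The quadratic form takes the value 1 + s^2 + s^2 = 1 at the image, which is thus an antiflag. *)
Lemma rep_refl C A c d v w s : rep C (c, d) -> rep A (v, w) ->
  bform (v, w) (c, d) = s -> rep (refl C A) (v + s *: c, w + s *: d).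
Proof.
move=> rC rA sE; rewrite /refl (rep_coords rC) (rep_coords rA) /= sE.
apply: rep_antiflag_of; rewrite !(dotDl, dotDr, dotZl, dotZr).
rewrite (only01_neq0 F2 (rep_dot rC)) (only01_neq0 F2 (rep_dot rA)).
rewrite [X in X != 0](_ : _ = 1 + (s * s + s * s)).
  by rewrite (only01_addxx F2) addr0 oner_neq0.
by rewrite -sE /bform /=; ring.
Qed.

Lemma rep_sim1 A B v w v' w' : rep A (v, w) -> rep B (v', w') ->
  sim1 A B = (bform (v, w) (v', w') != 0).
Proof.
move=> rA rB; rewrite sim1_incE (rep_inc rA rB) (rep_inc rB rA) /bform /=.
case: (F2 (dot v w')) => ->; case: (F2 (dot v' w)) => ->.
all: by rewrite ?addr0 ?add0r ?(only01_addxx F2) ?eqxx ?oner_eq0.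
Qed.

Lemma bform_refl c d v w v' w' : dot c d != 0 ->
  let s := bform (v, w) (c, d) in let s' := bform (v', w') (c, d) in
  bform (v + s *: c, w + s *: d) (v' + s' *: c, w' + s' *: d) = bform (v, w)
    (v', w').
Proof.
move=> /(only01_neq0 F2) cd s s';
  rewrite /bform /= !(dotDl, dotDr, dotZl, dotZr) cd.
transitivity (bform (v, w) (v', w') + (s * s' + s * s') + (s * s' + s * s')).
  by rewrite /s /s' /bform /=; ring.
by rewrite !(only01_addxx F2) !addr0.
Qed.

Lemma refl_sim1 C : {mono refl C : A B / sim1 A B}.
Proof.
move=> A B; have [[c d] rC] := rep_exists C.
have [[[v w] rA] [[v' w'] rB]] := (rep_exists A, rep_exists B).
rewrite (rep_sim1 (rep_refl rC rA erefl) (rep_refl rC rB erefl))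
  (rep_sim1 rA rB).
by rewrite bform_refl ?(rep_dot rC).
Qed.

Lemma refl_bij C : bijective (refl C).
Proof.
apply: inv_bij => A; have [[[c d] rC] [[v w] rA]] :=
  (rep_exists C, rep_exists A).
have cd := only01_neq0 F2 (rep_dot rC).
apply: (rep_inj _ rA); have := rep_refl rC (rep_refl rC rA erefl) erefl.
set s := bform (v, w) (c, d); set t := bform _ (c, d).
have -> : t = s.
  rewrite /t /bform /= !(dotDl, dotDr, dotZl, dotZr) cd.
  transitivity (bform (v, w) (c, d) + (s + s)); first by rewrite /bform /=;
    ring.
  by rewrite (only01_addxx F2) addr0.
by rewrite -!addrA -!scalerDl (only01_addxx F2) !scale0r !addr0.
Qed.

(** The reflection in (c, d) fixes A, where the polar form is 0, and moves B to B', where it is 1;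
    so [S] is not preserved. *)
Lemma refl_not_recoverable (S : rel (antiflag F n)) c d v w v' w' :
    dot c d != 0 -> dot v w != 0 -> dot v' w' != 0 ->
    bform (v, w) (c, d) = 0 -> bform (v', w') (c, d) = 1 ->
    (forall A B B', rep A (v, w) -> rep B (v', w') ->
      rep B' (v' + c, w' + d) -> S A B != S A B') ->
  ~ recoverable (@sim1 F n) S.
Proof.
move=> cd vw v'w' e0 e1 SAB; have [C rC] := rep_antiflag cd.
have [[A rA] [B rB]] := (rep_antiflag vw, rep_antiflag v'w').
move=> /(_ (refl C) (refl_bij C) (@refl_sim1 C)) /(_ A B).
have := rep_refl rC rA e0; rewrite !scale0r !addr0 => /(rep_inj rA) <-.
have := rep_refl rC rB e1; rewrite !scale1r => rB'.
by move/eqP; rewrite eq_sym; apply/negP/SAB.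
Qed.

Lemma sim1_not_recovers j : (2 < n)%N -> (2 <= j <= 4)%N ->
  ~ recoverable (@sim F n 1) (@sim F n j).
Proof.
move=> n_gt2 j24; have n0 : (0 < n)%N by apply: ltn_trans n_gt2.
have n1 : (1 < n)%N by apply: ltn_trans n_gt2.
pose e1 : 'rV[F]_n := delta_mx 0 (Ordinal n0).
pose e2 : 'rV[F]_n := delta_mx 0 (Ordinal n1).
pose e3 : 'rV[F]_n := delta_mx 0 (Ordinal n_gt2).
have E11 : dot e1 e1 = 1 by rewrite dot_delta.
have E12 : dot e1 e2 = 0 by rewrite dot_delta.
have E13 : dot e1 e3 = 0 by rewrite dot_delta.
have E21 : dot e2 e1 = 0 by rewrite dot_delta.
have E22 : dot e2 e2 = 1 by rewrite dot_delta.
have E23 : dot e2 e3 = 0 by rewrite dot_delta.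
have E31 : dot e3 e1 = 0 by rewrite dot_delta.
have E32 : dot e3 e2 = 0 by rewrite dot_delta.
have E33 : dot e3 e3 = 1 by rewrite dot_delta.
have E := (E11, E12, E13, (E21, E22, E23), (E31, E32, E33)).
have [x1 x2 x3] : [/\ e1 != 0, e2 != 0 & e3 != 0].
  by split; [apply: (dot_neq0 (v := e1) _).1 | apply: (dot_neq0 (v := e2) _).1
    | apply: (dot_neq0 (v := e3) _).1]; rewrite E oner_neq0.
pose simp := (dotDl, dotDr, E, addr0, add0r, @only01_addxx _ F2, @oner_neq0 F,
  eqxx).
have d33 : e1 + e3 + e3 = e1 by rewrite -addrA only01_addvv // addr0.
have d33' : e3 + (e1 + e3) = e1 by rewrite addrC d33.
have nsub u v z : dot u z = 1 -> dot v z = 0 -> ~~ (u <= v)%MS.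
  by move=> uz vz; apply/negP => /sub_dot/(_ vz); rewrite uz => /eqP;
    rewrite oner_eq0.
case: j j24 => [|[|[|[|[|j]]]]] //= _.
(* Here A ~2 B, while B' = (e1 + e2 + e3, e1) has the hyperplane of A, so A ~3 B'. The same
   configuration serves for ~3. *)
- apply: (@refl_not_recoverable _ (e1 + e2) (e1 + e3) e1 e1 e3 e3);
    rewrite /bform /= ?simp //.
  move=> A B B' rA rB rB'; rewrite (rep_sim2 rA rB) (rep_sim2 rA rB').
  by rewrite !simp (oner_eq0 F).
- apply: (@refl_not_recoverable _ (e1 + e2) (e1 + e3) e1 e1 e3 e3);
    rewrite /bform /= ?simp //.
  move=> A B B' rA rB rB'; rewrite (rep_sim3 rA rB) (rep_sim3 rA rB').
  have e13 : ~~ (e1 <= e3)%MS by apply: (nsub _ _ e1); rewrite !simp.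
  have e1e : ~~ (e1 <= (e3 + (e1 + e2))%R)%MS.
    by apply: (nsub _ _ (e1 + e2)); rewrite !simp.
  by rewrite d33' submx_refl (negPf e13) (negPf e1e).
(* Here A ~4 B, while B' = (e1 + e2 + e3, e1) again has the hyperplane of A. *)
apply: (@refl_not_recoverable _ e3 e3 e1 e1 (e1 + e2) (e1 + e3));
  rewrite /bform /= ?simp //.
move=> A B B' rA rB rB'; rewrite (rep_sim4 rA rB) (rep_sim4 rA rB') /generic.
have e1e2 : ~~ (e1 <= (e1 + e2)%R)%MS by apply: (nsub _ _ (e1 + e2));
  rewrite !simp.
have e1e3 : ~~ (e1 <= (e1 + e3)%R)%MS by apply: (nsub _ _ (e1 + e3));
  rewrite !simp.
by rewrite d33 submx_refl e1e2 e1e3 !simp andbF.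
Qed.
End Reflection.

Theorem theorem1 (F : fieldType) (n : nat) (hn : 3 <= n) :
  (forall i j : nat, 1 <= i <= 4 -> 1 <= j <= 4 -> i <> j ->
     card_ge F 3 \/ i <> 1 ->
     recoverable (@sim F n i) (@sim F n j))
  /\
  (card_eq F 2 ->
     forall j : nat, 2 <= j <= 4 ->
       ~ recoverable (@sim F n 1) (@sim F n j)).
Proof.
split=> [i j i14 j14 _ Fi|F2 j j24]; last first.
  by apply: sim1_not_recovers => //; apply: card_eq2_only01.
have r2 : recoverable (@sim2 F n) (@sim3 F n).
  exact: recover_by (@collinear2_bij _ _) (collinear2P hn).
apply: (@recoverable_trans _ _ (@sim F n 3)); last exact: sim3_recovers.
case: i i14 Fi => [|[|[|[|[|i]]]]] //= _ Fi.
- case: Fi => // /card_ge3_third_scalar Fb.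
  exact: recover_by (@collinear1_bij _ _) (fun A B => collinear1P hn A B Fb).
- by move=> f _.
(* For ~4 the criterion depends on the field and on n, which calls for the classical case
   distinction. *)
apply: recoverable_classically => b H;
  apply: (@third_scalar_or_only01 F) => Fb; apply: H.
have Fn (h : has_third_scalar F \/ 3 < n /\ only01 F)
  : recoverable (@sim4 F n) (@sim3 F n).
  exact: recover_by (@collinear4_bij _ _) (fun A B => collinear4P hn A B h).
case: Fb => [Fb|F2]; first by apply: Fn; left.
have [n_lt4|n_gt3] := ltnP n 4; last by apply: Fn; right.
apply: recoverable_trans r2.
exact: recover_by (@common_nbr_bij _ _) (fun A B =>
  common_nbrP hn A B F2 n_lt4).
Qed.
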